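(* Let $\mathcal M\in\mathbf{HC}$ be transitive, let $\pi=\langle\mathbb P_\xi:\xi\in|\pi|\rangle\in\mathcal M$ be a small multiforcing, and let $\rho=\langle\mathbb Q_\xi:\xi\in|\pi|\rangle$ be an $\mathcal M$-generic refinement of $\pi$, obtained from trees $Q_{\xi k}$ ($\xi\in|\pi|$, $k<\omega$) as in the context. Then: (i) $\rho$ is a small special multiforcing, $|\rho|=|\pi|$, and $\pi\sqsubset\rho$; (ii) if $\xi,\eta\in|\pi|$, $k,\ell<\omega$ and $\langle\xi,k\rangle\ne\langle\eta,\ell\rangle$, then $[Q_{\xi k}]\cap[Q_{\eta\ell}]=\emptyset$; (iii) if $\xi\in|\pi|$, $S\in\mathbb Q_\xi$ and $T\in\mathbb P_\xi$, then $[S]\cap[T]$ is clopen in $[S]$ and $T\not\subseteq S$; in particular $\mathbb Q_\xi\cap\mathbb P_\xi=\emptyset$; (iv) if $\xi\in|\pi|$ then $\mathbb Q_\xi$ is open dense in $\mathbb Q_\xi\cup\mathbb P_\xi$; (v) if $\xi\in|\pi|$ and a set $D\in\mathcal M$, $D\subseteq\mathbb P_\xi$, is pre-dense in $\mathbb P_\xi$, then $\mathbb P_\xi\sqsubset_D\mathbb Q_\xi$; (vi) if moreover $\pi=\bigsqcup_{\alpha<\lambda}\pi_\alpha$, where $\lambda<\omega_1$ and $\langle\pi_\alpha:\alpha<\lambda\rangle\in\mathcal M$ is a $\sqsubset$-increasing sequence of small special multiforcings, then $\pi_\alpha\sqsubset\rho$ for all $\alpha<\lambda$.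
   Context: $\mathbf{HC}$ is the set of hereditarily countable sets. $\mathbf{PT}$: perfect trees $T\subseteq 2^{<\omega}$; $[T]$ the set of branches; $T|s=\{t\in T:s\subseteq t\lor t\subseteq s\}$; trees are a.d. if their intersection is finite, and an antichain is a set of pairwise a.d. trees. An arboreal forcing is $\mathbb P\subseteq\mathbf{PT}$ with $T|u\in\mathbb P$ whenever $u\in T\in\mathbb P$; it is special if $\mathbb P=\{T|s:s\in T\in A\}$ for some finite or countable antichain $A\subseteq\mathbb P$. $\mathbb P^{\cup}$ denotes the set of finite unions of trees in $\mathbb P$. Refinement: $\mathbb P\sqsubset\mathbb Q$ iff every $T\in\mathbb P$ contains some $Q\in\mathbb Q$, every $Q\in\mathbb Q$ is covered by finitely many trees of $\mathbb P$, and for $Q\in\mathbb Q$, $T\in\mathbb P$, $[Q]\cap[T]$ is clopen in $[Q]$ and $T\not\subseteq Q$. For $D\subseteq\mathbb P$, $\mathbb P\sqsubset_D\mathbb Q$ means $\mathbb P\sqsubset\mathbb Q$ and every $S\in\mathbb Q$ is covered by finitely many trees from $D$. Pre-density is taken w.r.t. inclusion. A multiforcing is a function $\pi$ with domain $|\pi|\subseteq\omega_1$ whose values are arboreal forcings; it is small if $|\pi|$ and each $\pi(\xi)$ are countable, special if each $\pi(\xi)$ is special. $\pi\sqsubset\rho$ means $|\pi|\subseteq|\rho|$ and $\pi(\xi)\sqsubset\rho(\xi)$ for $\xi\in|\pi|$; $\bigsqcup_\alpha\pi_\alpha$ is the multiforcing with domain $\bigcup_\alpha|\pi_\alpha|$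 and value $\bigcup\{\pi_\alpha(\xi):\xi\in|\pi_\alpha|\}$ at $\xi$; $\langle\pi_\alpha\rangle$ is $\sqsubset$-increasing if $\pi_\alpha\sqsubset\pi_\beta$ for $\alpha<\beta$. Generic refinement. On $\omega\times\mathbf{PT}$ let $\langle n,T\rangle\preccurlyeq\langle m,S\rangle$ iff $m\le n$, $T\subseteq S$ and $T\cap 2^m=S\cap 2^m$. For a small multiforcing $\pi=\langle\mathbb P_\xi\rangle$, a $\pi$-system is a function $\varphi$ with finite domain $|\varphi|\subseteq|\pi|\times\omega$ and $\varphi(\xi,k)\in\mathbb P_\xi^{\cup}$; on pairs $\langle n,\varphi\rangle$ ($n<\omega$, $\varphi$ a $\pi$-system) let $\langle n,\varphi\rangle\preccurlyeq\langle m,\psi\rangle$ iff $|\psi|\subseteq|\varphi|$ and $\langle n,\varphi(\xi,k)\rangle\preccurlyeq\langle m,\psi(\xi,k)\rangle$ for all $\langle\xi,k\rangle\in|\psi|$. For $\mathcal M\in\mathbf{HC}$ let $\mathcal M^+$ be the (countable) set of all $X\in\mathbf{HC}$ definable in $\langle\mathbf{HC},\in\rangle$ by formulas with parameters in $\mathcal M$. Let $\langle\langle n_j,\varphi_j\rangle:j<\omega\rangle$ be a $\preccurlyeq$-decreasing sequence meeting every set $D\in\mathcal M^+$ of such pairs that is open dense (w.r.t. $\preccurlyeq$), with $n_0<n_1<\dots$ (passing to a subsequence). For each $\langle\xi,k\rangle\in|\pi|\times\omega$ there is $j(\xi,k)$ such that $\langle\xi,k\rangle\in|\varphi_j|$ for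 $j\ge j(\xi,k)$; put $Q_{\xi k}=\bigcap_{j\ge j(\xi,k)}\varphi_j(\xi,k)$ (a perfect tree) and $\mathbb Q_\xi=\{Q_{\xi k}|s:k<\omega,\ s\in Q_{\xi k}\}$. The multiforcing $\rho=\langle\mathbb Q_\xi:\xi\in|\pi|\rangle$ obtained this way is called an $\mathcal M$-generic refinement of $\pi$. *)

(* Defs.v *)
From HB Require Import structures.
From mathcomp Require Import all_boot all_order.
From mathcomp Require Import boolp classical_sets functions cardinality.
From mathcomp Require Import topology cantor.

Set Implicit Arguments.
Unset Strict Implicit.
Unset Printing Implicit Defensive.

Local Open Scope classical_set_scope.

(** * Hereditarily countable sets *)

(* Every hereditarily countable set is either empty or the range of a sequence
   of hereditarily countable sets; [pre_hc] consists of the well-founded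
   notations obtained in this way, and [HC] identifies two notations when they
   denote the same extensional set. *)
Inductive pre_hc : Type :=
| pre_empty
| pre_range of (nat -> pre_hc).

Fixpoint pre_eq (x y : pre_hc) : Prop :=
  match x, y with
  | pre_empty, pre_empty => True
  | pre_range f, pre_range g =>
      (forall i, exists j, pre_eq (f i) (g j)) /\
      (forall j, exists i, pre_eq (f i) (g j))
  | _, _ => False
  end.

Lemma pre_eq_refl x : pre_eq x x.
Proof. by elim: x => //= f IH; split=> i; exists i. Qed.

Lemma pre_eq_sym x y : pre_eq x y -> pre_eq y x.
Proof.
elim: x y => [|f IH] [|g] //= [fg gf]; split=> i.
- by have [j /IH] := gf i; exists j.
- by have [j /IH] := fg i; exists j.
Qed.

Lemma pre_eq_trans y x z : pre_eq x y -> pre_eq y z -> pre_eq x z.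
Proof.
elim: x y z => [|f IH] [|g] [|h] //= [fg gf] [gh hg]; split=> i.
- by have [j fgj] := fg i; have [k ghk] := gh j; exists k; apply: IH fgj ghk.
- by have [j ghj] := hg i; have [k fgk] := gf j; exists k; apply: IH fgk ghj.
Qed.

HB.instance Definition _ := gen_eqMixin pre_hc.
HB.instance Definition _ := gen_choiceMixin pre_hc.

Definition pre_eqb (x y : pre_hc) : bool := `[< pre_eq x y >].

Lemma pre_eqb_refl : reflexive pre_eqb.
Proof. by move=> x; apply/asboolP; apply: pre_eq_refl. Qed.

Lemma pre_eqb_sym : symmetric pre_eqb.
Proof. by move=> x y; apply/asboolP/asboolP; apply: pre_eq_sym. Qed.

Lemma pre_eqb_trans : transitive pre_eqb.
Proof.
by move=> y x z /asboolP xy /asboolP yz; apply/asboolP; apply: pre_eq_trans xy yz.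
Qed.

Canonical pre_eq_equiv : equiv_rel pre_hc :=
  EquivRel pre_eqb pre_eqb_refl pre_eqb_sym pre_eqb_trans.

Definition HC : Type := {eq_quot pre_eq_equiv}%qT.

HB.instance Definition _ := Choice.on HC.
HB.instance Definition _ := Quotient.on HC.
HB.instance Definition _ := EqQuotient.on HC.

Definition pre_in (x y : pre_hc) : Prop :=
  if y is pre_range f then exists i, pre_eq x (f i) else False.

Definition hin (x y : HC) : Prop := pre_in (repr x) (repr y).

Notation "x \inh y" := (hin x y) (at level 70, no associativity).

Definition hempty : HC := (\pi_HC pre_empty)%qT.

(* The element of [HC] whose members are those of [A]. It exists whenever [A]
   is countable ([hsetP]), which is the only case in which [hset] is meant to
   be used; it is junk otherwise. *)
Definition hset (A : set HC) : HC :=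
  xget hempty [set X | forall x, x \inh X <-> A x].

Lemma pre_repr_pi (x : pre_hc) : pre_eq (repr (\pi_HC x)%qT) x.
Proof. by apply/asboolP/(eqmodP pre_eq_equiv); rewrite reprK. Qed.

Lemma pre_eq_repr (x y : HC) : pre_eq (repr x) (repr y) -> x = y.
Proof.
by move=> xy; rewrite -[x]reprK -[y]reprK; apply/(eqmodP pre_eq_equiv)/asboolP.
Qed.

Lemma hinP (x : HC) (y : pre_hc) : x \inh (\pi_HC y)%qT <-> pre_in (repr x) y.
Proof.
rewrite /hin; have := pre_repr_pi y.
case: (repr _) => [|f]; case: y => [|g] //= [fg gf]; split=> -[i xi].
- by have [j fgj] := fg i; exists j; apply: pre_eq_trans fgj.
- by have [j fgj] := gf i; exists j; apply: pre_eq_trans (pre_eq_sym fgj).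
Qed.

Lemma hc_ext (x y : HC) : (forall z, z \inh x <-> z \inh y) -> x = y.
Proof.
move=> xy; apply: pre_eq_repr.
have {}xy (z : pre_hc) : pre_in z (repr x) <-> pre_in z (repr y).
  have E w : pre_in (repr (\pi_HC z)%qT) w <-> pre_in z w.
    have zz := pre_repr_pi z; case: w => [|f] //=.
    split=> -[i zi]; exists i; last exact: pre_eq_trans zi.
    exact: pre_eq_trans (pre_eq_sym zz) zi.
  by have := xy (\pi_HC z)%qT; rewrite /hin !E.
case: (repr x) (repr y) xy => [|f] [|g] //= xy.
- by have [_] := xy (g 0); apply; exists 0; apply: pre_eq_refl.
- by have [+ _] := xy (f 0); apply; exists 0; apply: pre_eq_refl.
- split=> i; first by apply/(proj1 (xy (f i))); exists i; apply: pre_eq_refl.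
  have [j gj] : pre_in (g i) (pre_range f).
    by apply/(proj2 (xy (g i))); exists i; apply: pre_eq_refl.
  by exists j; apply: pre_eq_sym.
Qed.

Lemma hsetP (A : set HC) : countable A -> forall x, x \inh hset A <-> A x.
Proof.
move=> cA; suff: exists X, forall x, x \inh X <-> A x.
  by rewrite /hset => /xgetPex; apply.
move/pfcard_geP: cA => [->|[f]]; first by exists hempty => x; rewrite hinP.
exists (\pi_HC (pre_range (repr \o f)))%qT => x; rewrite hinP /=; split.
  by move=> [i /pre_eq_repr ->]; apply: funS.
by move=> /(surj (f := f)) [i _ <-]; exists i; apply: pre_eq_refl.
Qed.

Definition hpair (x y : HC) : HC :=
  hset [set hset [set x]; hset [set x; y]].

Fixpoint hnat (n : nat) : HC :=
  if n is m.+1 then hset [set x | x \inh hnat m \/ x = hnat m] else hempty.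

Definition htransitive (x : HC) : Prop :=
  forall y z, z \inh y -> y \inh x -> z \inh x.

(* The ordinals belonging to [HC] are exactly the countable ordinals (von
   Neumann ordinals; foundation holds in [HC]). *)
Definition omega1 : set HC :=
  [set x | htransitive x /\ forall y, y \inh x -> htransitive y].

(** * Definability in (HC, in) *)

(* First-order formulas of the language {in, =}, with de Bruijn variables. *)
Inductive formula : Type :=
| FIn of nat & nat
| FEq of nat & nat
| FNot of formula
| FAnd of formula & formula
| FEx of formula.

Fixpoint sat (e : seq HC) (f : formula) : Prop :=
  match f with
  | FIn i j => nth hempty e i \inh nth hempty e j
  | FEq i j => nth hempty e i = nth hempty e j
  | FNot g => ~ sat e g
  | FAnd g h => sat e g /\ sat e h
  | FEx g => exists x, sat (x :: e) g
  end.

(* [M]^+. A variable outside the assignment [X :: ps] denotes the empty set,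
   which is definable without parameters. *)
Definition hplus (M : HC) : set HC :=
  [set X | exists f : formula, exists2 ps : seq HC,
    (forall i, i < size ps -> nth hempty ps i \inh M) &
    forall Y, sat (Y :: ps) f <-> Y = X].

(** * Partial functions *)

Definition pdom (A B : Type) (f : A -> option B) : set A := [set a | f a].

(* Set-theoretic code of a partial function, given codes of arguments and
   values. *)
Definition hfun (A B : Type) (cA : A -> HC) (cB : B -> HC)
    (f : A -> option B) : HC :=
  hset [set z | exists a b, f a = Some b /\ z = hpair (cA a) (cB b)].

(** * Trees *)

Definition tree : Type := set (seq bool).

(* A binary string is a function from its length to 2. *)
Definition hstring (s : seq bool) : HC :=
  hfun hnat (fun b : bool => hnat b) (onth s).

Definition htree (T : tree) : HC := hset (hstring @` T).

Definition perfect_tree : set tree := [set T : tree |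
  [/\ T !=set0,
      forall s t, T t -> prefix s t -> T s &
      forall s, T s -> exists t, [/\ prefix s t, T (rcons t false)
                                  & T (rcons t true)]]].

Definition branches (T : tree) : set cantor_space :=
  [set a : cantor_space | forall n, T (mkseq a n)].

Definition restr (T : tree) (s : seq bool) : tree :=
  [set t | T t /\ (prefix s t \/ prefix t s)].

Definition almost_disjoint (S T : tree) : Prop := finite_set (S `&` T).

Definition antichain (A : set tree) : Prop :=
  forall S T, A S -> A T -> S <> T -> almost_disjoint S T.

Definition relatively_clopen (X Y : set cantor_space) : Prop :=
  clopen (X `&` Y : set (subspace X)).

(** * Density *)

Definition open_in (X : Type) (le : X -> X -> Prop) (D P : set X) : Prop :=
  D `<=` P /\ forall p q, P p -> D q -> le p q -> D p.

Definition dense_in (X : Type) (le : X -> X -> Prop) (D P : set X) : Prop :=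
  D `<=` P /\ forall p, P p -> exists2 q, D q & le q p.

Definition pre_dense (D P : set tree) : Prop :=
  D `<=` P /\
  dense_in subset [set T | P T /\ exists2 S, D S & T `<=` S] P.

(** * Arboreal forcings *)

Definition arboreal (P : set tree) : Prop :=
  P `<=` perfect_tree /\ forall T u, P T -> T u -> P (restr T u).

Definition special_forcing (P : set tree) : Prop :=
  exists A : set tree, [/\ A `<=` P, countable A, antichain A &
    P = [set U | exists T s, [/\ A T, T s & U = restr T s]]].

(* Finite unions are unions of nonempty finite families, so that they are again
   perfect trees. *)
Definition fin_unions (P : set tree) : set tree :=
  [set T | exists F : set tree,
    [/\ finite_set F, F !=set0, F `<=` P & T = \bigcup_(S in F) S]].

Definition fin_covered (T : tree) (D : set tree) : Prop :=
  exists F : set tree,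
    [/\ finite_set F, F `<=` D & T `<=` \bigcup_(S in F) S].

Definition refines (P Q : set tree) : Prop :=
  [/\ forall T, P T -> exists2 S, Q S & S `<=` T,
      forall S, Q S -> fin_covered S P &
      forall S T, Q S -> P T ->
        relatively_clopen (branches S) (branches T) /\ ~ (T `<=` S)].

Definition refines_over (D P Q : set tree) : Prop :=
  refines P Q /\ forall S, Q S -> fin_covered S D.

Definition hforcing (P : set tree) : HC := hset (htree @` P).

(** * Multiforcings *)

Definition multi : Type := HC -> option (set tree).

Definition value (p : multi) (xi : HC) : set tree := odflt set0 (p xi).

Definition multiforcing (p : multi) : Prop :=
  pdom p `<=` omega1 /\ forall xi, pdom p xi -> arboreal (value p xi).

Definition small (p : multi) : Prop :=
  countable (pdom p) /\ forall xi, pdom p xi -> countable (value p xi).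

Definition special (p : multi) : Prop :=
  forall xi, pdom p xi -> special_forcing (value p xi).

Definition mrefines (p r : multi) : Prop :=
  pdom p `<=` pdom r /\
  forall xi, pdom p xi -> refines (value p xi) (value r xi).

Definition hmulti (p : multi) : HC := hfun id hforcing p.

(* Transfinite sequences of multiforcings are partial functions on [HC]. *)
Definition mseq_join (ps : HC -> option multi) : multi := fun xi =>
  if `[< exists a p, ps a = Some p /\ pdom p xi >] then
    Some [set T | exists a p, [/\ ps a = Some p, pdom p xi & value p xi T]]
  else None.

Definition mseq_increasing (ps : HC -> option multi) : Prop :=
  forall a b p q, ps a = Some p -> ps b = Some q -> a \inh b -> mrefines p q.

(** * Generic refinements *)

Definition tree_le (n : nat) (T : tree) (m : nat) (S : tree) : Prop :=
  [/\ m <= n, T `<=` S &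
      T `&` [set s | size s = m] = S `&` [set s | size s = m]].

Definition system : Type := HC * nat -> option tree.

Definition is_system (p : multi) (f : system) : Prop :=
  finite_set (pdom f) /\
  forall xi k T, f (xi, k) = Some T -> pdom p xi /\ fin_unions (value p xi) T.

Definition hsystem (f : system) : HC :=
  hfun (fun z : HC * nat => hpair z.1 (hnat z.2)) htree f.

Definition cond : Type := nat * system.

Definition conds (p : multi) : set cond := [set c | is_system p c.2].

Definition hcond (c : cond) : HC := hpair (hnat c.1) (hsystem c.2).

(* Since [tree_le] compares the two numbers, nothing is required of them when
   the domain of [d.2] is empty. *)
Definition cond_le (c d : cond) : Prop :=
  forall z S, d.2 z = Some S ->
    exists2 T, c.2 z = Some T & tree_le c.1 T d.1 S.

Definition generic_sequence (M : HC) (p : multi) (c : nat -> cond) : Prop :=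
  [/\ forall j, conds p (c j),
      forall j, cond_le (c j.+1) (c j),
      forall j, (c j).1 < (c j.+1).1 &
      forall D : set cond, D `<=` conds p -> hplus M (hset (hcond @` D)) ->
        open_in cond_le D (conds p) -> dense_in cond_le D (conds p) ->
        exists j, D (c j)].

(* The intersection of the trees [(c j).2 (xi, k)] over those [j] for which they
   are defined, i.e. over all [j] from some point on. The first conjunct can
   fail only if there is no tree at [xi] at all. *)
Definition limit_tree (c : nat -> cond) (xi : HC) (k : nat) : tree :=
  [set s | pdom (fun j => (c j).2 (xi, k)) !=set0 /\
           forall j T, (c j).2 (xi, k) = Some T -> T s].

Definition restrictions (Q : nat -> tree) : set tree :=
  [set U | exists k s, Q k s /\ U = restr (Q k) s].

Definition generic_refinement (M : HC) (p : multi) (Q : HC -> nat -> tree)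
    (r : multi) : Prop :=
  exists c : nat -> cond,
    [/\ generic_sequence M p c,
        forall xi k, pdom p xi -> Q xi k = limit_tree c xi k &
        r = fun xi => if p xi then Some (restrictions (Q xi)) else None].

(* Main.v *)
(* Since every countable subset of HC is an element of HC, notions given by a
   countable inductive closure (natural number, finite set) are first-order
   definable over HC; hence so are the set of (codes of) conditions and the
   dense sets below, and membership in [hplus M] reduces to closing definable
   relations under connectives and quantifiers.

   Everything about the limit trees follows from four families of open dense
   sets, which force: that the tree at [(xi, k)] is covered by finitely many
   trees from a given definable dense subset of the forcing at [xi]; that a
   given string splits below the current height; that the trees at two
   different indices are almost disjoint; and that some tree at [xi] is
   contained in a given tree of the forcing at [xi]. They are dense because, at
   the current height [n], a tree may be replaced by the union of arbitrary
   subtrees chosen above each of its nodes of length [n]. *)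

Require Import Defs.
From mathcomp Require Import all_boot all_order.
From mathcomp Require Import mathcomp_extra boolp classical_sets functions cardinality.
From mathcomp Require Import topology function_spaces cantor.

Set Implicit Arguments.
Unset Strict Implicit.
Unset Printing Implicit Defensive.

Local Open Scope classical_set_scope.

(** * Sets in HC *)

Lemma hemptyP x : ~ x \inh hempty.
Proof. by rewrite hinP. Qed.

(** Foundation comes from structural induction on a representing notation: every member of the set
    denoted by [pre_range f] is the class of some [f i]. *)
Lemma hin_ind (P : HC -> Prop) :
  (forall x, (forall y, y \inh x -> P y) -> P x) -> forall x, P x.
Proof.
move=> IH x; rewrite -[x]reprK; elim: (repr x) => [|f IHf]; apply: IH => y.
  by rewrite hinP.
rewrite hinP => -[i yfi]; suff -> : y = (\pi_HC (f i))%qT by [].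
apply: pre_eq_repr; apply: pre_eq_trans yfi _.
exact/pre_eq_sym/pre_repr_pi.
Qed.

Lemma hin_irr x : ~ x \inh x.
Proof. by elim/hin_ind: x => x IH xx; apply: (IH x xx). Qed.

Lemma countable_hin x : countable [set y | y \inh x].
Proof.
rewrite -[x]reprK; case: (repr x) => [|f].
  by rewrite (_ : mkset _ = set0) ?predeqE // => y; split=> // /hemptyP.
rewrite (_ : mkset _ = range (fun i => \pi_HC (f i))%qT).
  exact/card_image_le.
rewrite predeqE => y; rewrite /= hinP; split=> -[i].
  move=> yfi; exists i => //; apply: pre_eq_repr; apply: pre_eq_trans (pre_repr_pi _) _.
  exact: pre_eq_sym.
by move=> _ <-; exists i; apply: pre_repr_pi.
Qed.

Lemma hset_hin x : hset [set y | y \inh x] = x.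
Proof. by apply: hc_ext => z; rewrite hsetP //; apply: countable_hin. Qed.

Lemma in_hset1 x z : z \inh hset [set x] <-> z = x.
Proof. by rewrite hsetP. Qed.

Lemma in_hset2 x y z : z \inh hset [set x; y] <-> z = x \/ z = y.
Proof. by rewrite hsetP //; apply/finite_set_countable/finite_set2. Qed.

Lemma hpair_inj x y x' y' : hpair x y = hpair x' y' -> x = x' /\ y = y'.
Proof.
move=> E; have {E} P z : (z = hset [set x] \/ z = hset [set x; y]) <->
    (z = hset [set x'] \/ z = hset [set x'; y']).
  by rewrite -!in_hset2 -/(hpair x y) E.
have xx' : x = x'.
  have [/(_ (or_introl erefl))[] E _] := P (hset [set x]).
    by apply/in_hset1; rewrite -E; apply/in_hset1.
  by apply/esym/in_hset1; rewrite E; apply/in_hset2; left.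
split=> //; rewrite -{}xx' {x'} in P.
have [/(_ (or_intror erefl)) E1 _] := P (hset [set x; y]).
have [_ /(_ (or_intror erefl)) E2] := P (hset [set x; y']).
have H1 u w : hset [set u; w] = hset [set u] -> w = u.
  by move=> E; apply/in_hset1; rewrite -E; apply/in_hset2; right.
case: E1 => E1; case: E2 => E2.
- by rewrite (H1 _ _ E1) (H1 _ _ E2).
- by rewrite (H1 _ _ E1); apply/esym/H1; rewrite E2.
- by rewrite (H1 _ _ E2); apply/H1; rewrite E1.
- have : y \inh hset [set x; y'] by rewrite -E1; apply/in_hset2; right.
  case/in_hset2 => // yx; have : y' \inh hset [set x; y].
    by rewrite E1; apply/in_hset2; right.
  by case/in_hset2 => // ->.
Qed.

(** One adjunction operation serves twice: [hadd x x] is the ordinal successor, and adjoining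
    elements one by one to [hempty] yields the finite sets. *)
Definition hadd (x y : HC) := hset [set z | z \inh x \/ z = y].

Lemma in_hadd x y z : z \inh hadd x y <-> z \inh x \/ z = y.
Proof.
rewrite hsetP //; rewrite (_ : mkset _ = \bigcup_(b in [set: bool])
  if b then [set y | y \inh x] else [set y]); last first.
  rewrite predeqE => w; split=> [[?|?]|[[] _ ?]];
    by [exists true | exists false | left | right].
apply: bigcup_countable => // -[] _; [exact: countable_hin | exact: countable1].
Qed.

Lemma in_hnat n z : z \inh hnat n <-> exists2 m, m < n & z = hnat m.
Proof.
elim: n => [|n IH] /=; first by split=> [/hemptyP|[]].
rewrite in_hadd IH; split=> [[[m mn ->]| ->]|[m]].
- by exists m => //; apply: ltnW.
- by exists n.
- by rewrite ltnS leq_eqVlt => /predU1P[->|mn] ->; [right | left; exists m].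
Qed.

Lemma hnat_inj : injective hnat.
Proof.
have H m n : m < n -> hnat m <> hnat n.
  by move=> mn E; apply: (@hin_irr (hnat n)); apply/in_hnat; exists m.
move=> m n E; case: (ltngtP m n) => // /H; first by move/(_ E).
by move/(_ (esym E)).
Qed.

Lemma in_hnatE m n : hnat m \inh hnat n <-> m < n.
Proof.
by rewrite in_hnat; split=> [[k kn /hnat_inj->]|] //; exists m.
Qed.

Definition hsub (x y : HC) := forall z, z \inh x -> z \inh y.

Definition hfinite (x : HC) := finite_set [set y | y \inh x].

Definition hnatural (x : HC) := exists n, x = hnat n.

(** Supplies the countability that lets families of finite sets be elements of HC: the witness in
    [dfn_hfinite], and later the codes of conditions. *)
Lemma countable_finite_hsets (A : set HC) : countable A ->
  countable [set y | hfinite y /\ forall z, z \inh y -> A z].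
Proof.
move=> /countable_finite_subset; apply: sub_countable.
apply: card_le_trans (card_image_le hset _).
apply: subset_card_le => y [fy yA].
by exists [set z | z \inh y]; rewrite ?hset_hin.
Qed.

Lemma hfinite_hset (A : set HC) : finite_set A -> hfinite (hset A).
Proof.
move=> fA; rewrite /hfinite (_ : [set _ | _] = A) // predeqE => z.
exact/hsetP/finite_set_countable.
Qed.

(** * Definability over HC *)

Fixpoint fren (r : nat -> nat) (f : formula) : formula :=
  match f with
  | FIn i j => FIn (r i) (r j)
  | FEq i j => FEq (r i) (r j)
  | FNot g => FNot (fren r g)
  | FAnd g h => FAnd (fren r g) (fren r h)
  | FEx g => FEx (fren (fun i => if i is j.+1 then (r j).+1 else 0) g)
  end.

Lemma sat_fren f r (e e' : seq HC) :
  (forall i, nth hempty e' i = nth hempty e (r i)) -> sat e (fren r f) <-> sat e' f.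
Proof.
elim: f r e e' => [i j|i j|g IH|g IHg h IHh|g IH] r e e' E /=.
- by rewrite !E.
- by rewrite !E.
- by rewrite (IH r e e').
- by rewrite (IHg r e e') // (IHh r e e').
- by split=> -[x gx]; exists x; move: gx; apply IH; case.
Qed.

(** One formula must work in every environment, of any length; positions past the end read as
    [hempty]. *)
Definition dfn (R : seq HC -> Prop) := exists f, forall e, sat e f <-> R e.

(* The graph of [t] is definable: the value is at the head of the environment
   and the arguments follow it. *)
Definition tm (t : seq HC -> HC) := dfn (fun e => nth hempty e 0 = t (behead e)).

Lemma dfn_ext R S : (forall e, R e <-> S e) -> dfn S -> dfn R.
Proof. by move=> RS [f fS]; exists f => e; rewrite fS RS. Qed.

Lemma dfn_not R : dfn R -> dfn (fun e => ~ R e).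
Proof. by move=> [f fR]; exists (FNot f) => e /=; rewrite fR. Qed.

Lemma dfn_and R S : dfn R -> dfn S -> dfn (fun e => R e /\ S e).
Proof. by move=> [f fR] [g gS]; exists (FAnd f g) => e /=; rewrite fR gS. Qed.

Lemma dfn_or R S : dfn R -> dfn S -> dfn (fun e => R e \/ S e).
Proof.
move=> dR dS; apply: (dfn_ext _ (dfn_not (dfn_and (dfn_not dR) (dfn_not dS)))).
by move=> e; rewrite not_andE !notK.
Qed.

Lemma dfn_imp (R S : seq HC -> Prop) : dfn R -> dfn S -> dfn (fun e => R e -> S e).
Proof.
move=> dR dS; apply: (dfn_ext _ (dfn_or (dfn_not dR) dS)) => e.
by rewrite implyE.
Qed.

Lemma dfn_iff R S : dfn R -> dfn S -> dfn (fun e => R e <-> S e).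
Proof. by move=> dR dS; apply: dfn_and; apply: dfn_imp. Qed.

Lemma dfn_ex (R : HC -> seq HC -> Prop) :
  dfn (fun e => R (nth hempty e 0) (behead e)) -> dfn (fun e => exists x, R x e).
Proof.
move=> [f fR]; exists (FEx f) => e /=.
by split=> -[x] H; exists x; move: H; rewrite fR.
Qed.

Lemma dfn_all (R : HC -> seq HC -> Prop) :
  dfn (fun e => R (nth hempty e 0) (behead e)) -> dfn (fun e => forall x, R x e).
Proof.
move=> dR; apply: (dfn_ext _ (dfn_not (dfn_ex (R := fun x e => ~ R x e) (dfn_not dR)))) => e.
split=> [H [x nR]|H x]; first exact: nR.
by apply: contrapT => nR; apply: H; exists x.
Qed.

(** Weakening under one binder: the renaming fixes variable 0, the slot holding the value of a term,
    and skips variable 1. *)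
Lemma dfn_drop1 R : dfn R -> dfn (fun e => R (nth hempty e 0 :: behead (behead e))).
Proof.
move=> [f fR]; exists (fren (fun i => if i is j.+1 then j.+2 else 0) f) => e.
by rewrite -fR; apply: sat_fren => -[|i] //=; rewrite !nth_behead.
Qed.

Lemma tm_shift t : tm t -> tm (fun e => t (behead e)).
Proof. exact: dfn_drop1. Qed.

(** A term is eliminated by quantifying over its value, so definable graphs can be substituted into
    definable relations. *)
Lemma dfn_let t (R : HC -> seq HC -> Prop) : tm t ->
  dfn (fun e => R (nth hempty e 0) (behead e)) -> dfn (fun e => R (t e) e).
Proof.
move=> dt dR; apply: (@dfn_ext _ (fun e => exists x, x = t e /\ R x e)).
  by move=> e; split=> [H|[_ [-> //]]]; exists (t e).
by apply: dfn_ex; apply: dfn_and.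
Qed.

Lemma dfn_app1 (R : HC -> Prop) t :
  dfn (fun e => R (nth hempty e 0)) -> tm t -> dfn (fun e => R (t e)).
Proof. by move=> dR dt; apply: (dfn_let (R := fun x _ => R x)). Qed.

(** The arguments are named from last to first; each new binder shifts the remaining terms by one
    [behead]. *)
Lemma dfn_app2 (R : HC -> HC -> Prop) s t :
  dfn (fun e => R (nth hempty e 0) (nth hempty e 1)) -> tm s -> tm t ->
  dfn (fun e => R (s e) (t e)).
Proof.
move=> dR ds dt; apply: (dfn_let (R := fun y e => R (s e) y)) => //.
apply: (dfn_let (R := fun x e => R x (nth hempty e 0))); first exact: tm_shift.
by apply: dfn_ext dR => e; rewrite nth_behead.
Qed.

Lemma dfn_app3 (R : HC -> HC -> HC -> Prop) s t u :
  dfn (fun e => R (nth hempty e 0) (nth hempty e 1) (nth hempty e 2)) ->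
  tm s -> tm t -> tm u -> dfn (fun e => R (s e) (t e) (u e)).
Proof.
move=> dR ds dt du; apply: (dfn_let (R := fun z e => R (s e) (t e) z)) => //.
apply: (dfn_let (R := fun y e => R (s (behead e)) y (nth hempty e 0))).
  exact: tm_shift.
apply: (dfn_let (R := fun x e => R x (nth hempty e 0) (nth hempty (behead e) 0))).
  exact: (tm_shift (tm_shift ds)).
by apply: dfn_ext dR => e; rewrite !nth_behead.
Qed.

Lemma dfn_app4 (R : HC -> HC -> HC -> HC -> Prop) s t u v :
  dfn (fun e => R (nth hempty e 0) (nth hempty e 1) (nth hempty e 2) (nth hempty e 3)) ->
  tm s -> tm t -> tm u -> tm v -> dfn (fun e => R (s e) (t e) (u e) (v e)).
Proof.
move=> dR ds dt du dv; apply: (dfn_let (R := fun z e => R (s e) (t e) (u e) z)) => //.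
apply: (dfn_let (R := fun y e => R (s (behead e)) (t (behead e)) y (nth hempty e 0))).
  exact: tm_shift.
apply: (dfn_let (R := fun x e => R (s (behead (behead e))) x (nth hempty e 0)
    (nth hempty (behead e) 0))).
  exact: (tm_shift (tm_shift dt)).
apply: (dfn_let (R := fun x e => R x (nth hempty e 0) (nth hempty (behead e) 0)
    (nth hempty (behead (behead e)) 0))).
  exact: (tm_shift (tm_shift (tm_shift ds))).
by apply: dfn_ext dR => e; rewrite !nth_behead.
Qed.

Lemma tm_nth i : tm (fun e => nth hempty e i).
Proof. by exists (FEq 0 i.+1) => e; rewrite nth_behead. Qed.

Lemma tm_ext s t : (forall e, s e = t e) -> tm t -> tm s.
Proof. by move=> st; apply: dfn_ext => e; rewrite st. Qed.

Lemma dfn_eq s t : tm s -> tm t -> dfn (fun e => s e = t e).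
Proof. by apply: (dfn_app2 (R := eq)); exists (FEq 0 1). Qed.

Lemma dfn_in s t : tm s -> tm t -> dfn (fun e => s e \inh t e).
Proof. by apply: (dfn_app2 (R := hin)); exists (FIn 0 1). Qed.

(** Passing under several quantifiers leaves [nth] of iterated [behead]; the rewriting collapses it
    to a single de Bruijn index. *)
Ltac dfn_var := lazymatch goal with |- tm (fun e => nth hempty _ _) =>
  eapply tm_ext; [intro; rewrite ?nth_behead; reflexivity | apply tm_nth] end.

Create HintDb dfn.
#[local] Hint Resolve dfn_not dfn_and dfn_or dfn_imp dfn_iff dfn_ex dfn_all
  dfn_eq dfn_in : dfn.
#[local] Hint Extern 0 (tm _) => dfn_var : dfn.

Ltac dfn_auto := solve [cbv beta; eauto 40 with dfn].

Lemma dfn_sub s t : tm s -> tm t -> dfn (fun e => hsub (s e) (t e)).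
Proof. apply: dfn_app2; rewrite /hsub; dfn_auto. Qed.

Lemma tm_app1 (F : HC -> HC) t :
  dfn (fun e => nth hempty e 0 = F (nth hempty e 1)) -> tm t -> tm (fun e => F (t e)).
Proof.
move=> dF dt; apply: (dfn_app2 (R := fun z x => z = F x)) => //.
  exact: (tm_nth 0).
exact: tm_shift.
Qed.

Lemma tm_app2 (F : HC -> HC -> HC) s t :
  dfn (fun e => nth hempty e 0 = F (nth hempty e 1) (nth hempty e 2)) ->
  tm s -> tm t -> tm (fun e => F (s e) (t e)).
Proof.
move=> dF ds dt; apply: (dfn_app3 (R := fun z x y => z = F x y)) => //.
- exact: (tm_nth 0).
- exact: tm_shift.
- exact: tm_shift.
Qed.

Lemma hset_eqP (A : set HC) x : countable A ->
  x = hset A <-> forall z, z \inh x <-> A z.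
Proof.
move=> cA; split=> [-> z|H]; first exact: hsetP.
by apply: hc_ext => z; rewrite H hsetP.
Qed.

Lemma tm_hset1 t : tm t -> tm (fun e => hset [set t e]).
Proof.
apply: (tm_app1 (F := fun x => hset [set x])).
apply: (@dfn_ext _ (fun e => forall z, z \inh nth hempty e 0 <-> z = nth hempty e 1)).
  by move=> e; rewrite hset_eqP.
dfn_auto.
Qed.

Lemma tm_hset2 s t : tm s -> tm t -> tm (fun e => hset [set s e; t e]).
Proof.
apply: (tm_app2 (F := fun x y => hset [set x; y])).
apply: (@dfn_ext _ (fun e => forall z, z \inh nth hempty e 0 <->
    z = nth hempty e 1 \/ z = nth hempty e 2)).
  by move=> e; rewrite hset_eqP //; apply/finite_set_countable/finite_set2.
dfn_auto.
Qed.

Lemma tm_hpair s t : tm s -> tm t -> tm (fun e => hpair (s e) (t e)).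
Proof. by move=> ds dt; apply: tm_hset2; [apply: tm_hset1 | apply: tm_hset2]. Qed.

Lemma tm_hempty : tm (fun=> hempty).
Proof.
apply: (@dfn_ext _ (fun e => forall z, ~ z \inh nth hempty e 0)).
  move=> e; split=> [->|H]; first exact: hemptyP.
  by apply: hc_ext => z; split=> [/H|/hemptyP].
dfn_auto.
Qed.

#[local] Hint Resolve tm_hpair tm_hempty dfn_sub : dfn.

Lemma tm_hadd s t : tm s -> tm t -> tm (fun e => hadd (s e) (t e)).
Proof.
apply: tm_app2.
apply: (@dfn_ext _ (fun e => forall z, z \inh nth hempty e 0 <->
    z \inh nth hempty e 1 \/ z = nth hempty e 2)).
  move=> e; split=> [-> z|H]; first exact: in_hadd.
  by apply: hc_ext => z; rewrite H in_hadd.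
dfn_auto.
Qed.
#[local] Hint Resolve tm_hadd : dfn.

Lemma tm_hnat n : tm (fun=> hnat n).
Proof.
elim: n => [|n IH]; first exact: tm_hempty.
exact: (tm_hadd IH IH).
Qed.
#[local] Hint Resolve tm_hnat : dfn.

(** Natural numbers are the members of every inductive set. The quantifier ranges over HC only, but
    the set of natural numbers is countable and hence is itself one of the sets tested. *)
Lemma dfn_hnatural t : tm t -> dfn (fun e => hnatural (t e)).
Proof.
apply: dfn_app1.
apply: (@dfn_ext _ (fun e => forall W, hempty \inh W ->
   (forall x, x \inh W -> hadd x x \inh W) -> nth hempty e 0 \inh W)); last first.
  dfn_auto.
move=> e; split=> [[n ->] W W0 WS|H].
  by elim: n => [//|n IH]; apply: (WS _ IH).
have cN : countable (range hnat) by exact/card_image_le.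
suff : nth hempty e 0 \inh hset (range hnat) by rewrite hsetP // => -[n _ <-]; exists n.
apply: H => [|x]; rewrite !hsetP //; first by exists 0.
by move=> [n _ <-]; exists n.+1.
Qed.

Lemma dfn_hfinite t : tm t -> dfn (fun e => hfinite (t e)).
Proof.
apply: dfn_app1.
apply: (@dfn_ext _ (fun e => forall W, hempty \inh W ->
   (forall x y, x \inh W -> y \inh nth hempty e 0 -> hadd x y \inh W) ->
   nth hempty e 0 \inh W)); last first.
  dfn_auto.
move=> e; set x := nth hempty e 0; split=> [fx W W0 WS|H].
  have /finite_seqP[s xs] := fx; have {xs} xs y : y \inh x <-> y \in s.
    by have /= -> := congr1 (@^~ y) xs.
  have cs (r : seq HC) : countable [set y | y \in r].
    exact/finite_set_countable/finite_seq.
  (* [x] is built up inside [W] one element at a time, along a finite enumeration. *)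
  suff: forall r : seq HC, {subset r <= s} -> hset [set y | y \in r] \inh W.
    by move/(_ s (fun _ => id)); rewrite (_ : hset _ = x) //; apply: hc_ext => y;
       rewrite hsetP // xs.
  elim=> [|y r IH] rs.
    rewrite (_ : hset _ = hempty) //; apply: hc_ext => y; rewrite hsetP //.
    by split=> // /hemptyP.
  rewrite (_ : hset _ = hadd (hset [set y | y \in r]) y).
    apply: WS; first by apply: IH => z zr; apply: rs; rewrite inE zr orbT.
    by apply/xs/rs; rewrite inE eqxx.
  apply: hc_ext => z; rewrite in_hadd !hsetP //= inE.
  by split=> [/predU1P[|]|[|/eqP]] -> //; [right|left|rewrite orbT].
(* The converse tests the family of finite subsets of [x], which is countable and hence an element
   of HC. *)
have cW : countable [set y | hfinite y /\ hsub y x].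
  exact: countable_finite_hsets (countable_hin x).
suff : x \inh hset [set y | hfinite y /\ hsub y x] by rewrite hsetP // => -[].
apply: H => [|y z]; rewrite !hsetP //.
  by split=> [|z /hemptyP//]; apply: sub_finite_set (finite_set0 _) => z /hemptyP.
move=> [fy yx] zx; split=> [|w /in_hadd[/yx|->]] //.
apply: (@sub_finite_set _ _ ([set w | w \inh y] `|` [set z])) => [w|].
  by case/in_hadd=> [|->]; [left | right].
by rewrite finite_setU; split=> //; apply: finite_set1.
Qed.
#[local] Hint Resolve dfn_hnatural dfn_hfinite : dfn.

(** * Codes *)

Lemma in_hfun (A B : Type) (cA : A -> HC) (cB : B -> HC) (f : A -> option B) z :
  countable (pdom f) ->
  z \inh hfun cA cB f <-> exists a b, f a = Some b /\ z = hpair (cA a) (cB b).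
Proof.
move=> cf; rewrite hsetP //; pose g a := if f a is Some b then hpair (cA a) (cB b) else hempty.
apply: sub_countable cf; apply: card_le_trans (card_image_le g _).
by apply: subset_card_le => _ [a [b [fa ->]]]; exists a; rewrite /g /pdom /= fa.
Qed.

Lemma in_hfun_pair (A B : Type) (cA : A -> HC) (cB : B -> HC) (f : A -> option B) a y :
  countable (pdom f) -> injective cA ->
  hpair (cA a) y \inh hfun cA cB f <-> exists2 b, f a = Some b & y = cB b.
Proof.
move=> cf iA; rewrite in_hfun //; split=> [[a' [b [fa' /hpair_inj[/iA -> ->]]]]|[b fa ->]].
  by exists b.
by exists a, b.
Qed.

Lemma hbool_inj : injective (fun b : bool => hnat b).
Proof. by move=> [] [] /hnat_inj. Qed.

Lemma in_hstring s z : z \inh hstring s <->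
  exists i (b : bool), onth s i = Some b /\ z = hpair (hnat i) (hnat b).
Proof. exact/in_hfun/countableP. Qed.

Lemma in_hstring_pair s i y : hpair (hnat i) y \inh hstring s <->
  exists2 b : bool, onth s i = Some b & y = hnat b.
Proof. exact/in_hfun_pair/hnat_inj/countableP. Qed.

Lemma prefix_onthP (T : eqType) (s t : seq T) :
  prefix s t <-> forall i b, onth s i = Some b -> onth t i = Some b.
Proof.
elim: s t => [|x s IH] [|y t] /=; try by [split=> // _ []].
  by split=> // /(_ 0 x erefl).
split=> [/andP[/eqP-> st] [|i] b //=|H]; first exact: (proj1 (IH t) st i b).
by apply/andP; split; [have [->] := H 0 x erefl | apply/IH => i; apply: (H i.+1)].
Qed.

(** Strings are coded as finite functions, so extension of strings is inclusion of graphs and can be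
    defined without mentioning lengths. *)
Lemma hsub_hstring s t : hsub (hstring s) (hstring t) <-> prefix s t.
Proof.
rewrite prefix_onthP; split=> H.
  move=> i b sib; have /H/in_hstring_pair[b' -> /hbool_inj->//] :
    hpair (hnat i) (hnat b) \inh hstring s by apply/in_hstring_pair; exists b.
by move=> z /in_hstring[i [b [/H ti ->]]]; apply/in_hstring; exists i, b.
Qed.

Lemma prefix_anti (T : eqType) (s t : seq T) : prefix s t -> prefix t s -> s = t.
Proof.
move=> /prefixP[u ->] /size_prefix; rewrite size_cat -[X in _ <= X]addn0 leq_add2l.
by rewrite leqn0 => /nilP ->; rewrite cats0.
Qed.

Lemma hstring_inj : injective hstring.
Proof. by move=> s t st; apply: prefix_anti; apply/hsub_hstring; rewrite st. Qed.

(** For the code of a string and a natural number [n], this bounds the length by [n]; it speaks of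
    the domain, so that no length function has to be defined. *)
Definition hbounded (u n : HC) := forall i b, hpair i b \inh u -> i \inh n.

Lemma hbounded_hstring s n : hbounded (hstring s) (hnat n) <-> size s <= n.
Proof.
split=> [H|sn i b].
  (* The last position of [b :: s] is [size s], and its being below [n] is the claim. *)
  case: s H => [//|b s] H; have /in_hnatE // : hnat (size s) \inh hnat n.
  apply: (H _ (hnat (last b s))); apply/in_hstring_pair; exists (last b s) => //.
  by rewrite onthE (nth_map b) ?nth_last.
rewrite in_hstring => -[j [c [sj /hpair_inj[-> _]]]]; apply/in_hnatE.
by apply: leq_trans sn; rewrite -onthTE sj.
Qed.

Lemma in_htree T z : z \inh htree T <-> exists2 s, T s & z = hstring s.
Proof.
rewrite hsetP; last exact: sub_countable (card_image_le _ _) (countableP T).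
by split=> -[s Ts e]; exists s.
Qed.

Lemma hstring_in_htree T s : hstring s \inh htree T <-> T s.
Proof. by rewrite in_htree; split=> [[t Tt /hstring_inj->//]|Ts]; exists s. Qed.

Lemma hsub_htree S T : hsub (htree S) (htree T) <-> S `<=` T.
Proof.
split=> [H s /hstring_in_htree/H/hstring_in_htree //|ST z].
by rewrite !in_htree => -[s /ST Ts ->]; exists s.
Qed.

Lemma htree_inj : injective htree.
Proof. by move=> S T E; apply/seteqP; split; apply/hsub_htree; rewrite E. Qed.

Lemma in_hforcing P z : countable P ->
  z \inh hforcing P <-> exists2 T, P T & z = htree T.
Proof.
move=> cP; rewrite hsetP; last by apply: sub_countable cP; apply: card_image_le.
by split=> -[T PT e]; exists T.
Qed.

Lemma htree_in_hforcing P T : countable P -> htree T \inh hforcing P <-> P T.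
Proof.
by move=> cP; rewrite in_hforcing //; split=> [[S PS /htree_inj->//]|PT]; exists T.
Qed.

Lemma finite_inj_image (A B : Type) (f : A -> B) (X : set A) : injective f ->
  finite_set (f @` X) -> finite_set X.
Proof. by move=> fi; rewrite (eq_finite_set (inj_card_eq (in2W fi))). Qed.

(** * Formulas recognizing codes of conditions *)

Definition hfin_union (U P : HC) := exists F, [/\ hfinite F,
  exists S, S \inh F, hsub F P & forall t, t \inh U <-> exists S, S \inh F /\ t \inh S].

Definition hsystem_pred (f p : HC) := [/\ hfinite f,
  forall w, w \inh f -> exists xi k P T, [/\ hnatural k, hpair xi P \inh p,
     hfin_union T P & w = hpair (hpair xi k) T] &
  forall w S T, hpair w S \inh f -> hpair w T \inh f -> S = T].

Definition hcond_pred (z p : HC) := exists n f,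
  [/\ z = hpair n f, hnatural n & hsystem_pred f p].

Lemma dfn_and3 R S T : dfn R -> dfn S -> dfn T -> dfn (fun e => [/\ R e, S e & T e]).
Proof.
move=> dR dS dT; apply: (dfn_ext _ (dfn_and dR (dfn_and dS dT))) => e.
by split=> [[]|[? []]].
Qed.

Lemma dfn_and4 R S T U : dfn R -> dfn S -> dfn T -> dfn U ->
  dfn (fun e => [/\ R e, S e, T e & U e]).
Proof.
move=> dR dS dT dU; apply: (dfn_ext _ (dfn_and dR (dfn_and3 dS dT dU))) => e.
by split=> [[]|[? []]].
Qed.
#[local] Hint Resolve dfn_and3 dfn_and4 : dfn.

Lemma dfn_hbounded s t : tm s -> tm t -> dfn (fun e => hbounded (s e) (t e)).
Proof. apply: dfn_app2; rewrite /hbounded; dfn_auto. Qed.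

Lemma dfn_hfin_union s t : tm s -> tm t -> dfn (fun e => hfin_union (s e) (t e)).
Proof. apply: dfn_app2; rewrite /hfin_union; dfn_auto. Qed.
#[local] Hint Resolve dfn_hbounded dfn_hfin_union : dfn.

Lemma dfn_hsystem_pred s t : tm s -> tm t -> dfn (fun e => hsystem_pred (s e) (t e)).
Proof. apply: dfn_app2; rewrite /hsystem_pred; dfn_auto. Qed.
#[local] Hint Resolve dfn_hsystem_pred : dfn.

Lemma dfn_hcond_pred s t : tm s -> tm t -> dfn (fun e => hcond_pred (s e) (t e)).
Proof. apply: dfn_app2; rewrite /hcond_pred; dfn_auto. Qed.

Lemma hfinite_sub_hforcing F P : countable P -> hfinite F -> hsub F (hforcing P) ->
  exists F0 : set tree, [/\ finite_set F0, F0 `<=` P &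
    forall z, z \inh F <-> exists2 S, F0 S & z = htree S].
Proof.
move=> cP fF FP; exists [set S | htree S \inh F]; split.
- apply: (finite_inj_image htree_inj); apply: sub_finite_set fF.
  by move=> _ [S SF <-].
- by move=> S /FP/(htree_in_hforcing _ cP).
- move=> z; split=> [zF|[S SF ->] //]; have /(in_hforcing _ cP)[S _ zS] := FP _ zF.
  by exists S => //; rewrite /= -zS.
Qed.

Lemma hfinite_hforcing F : finite_set F -> hfinite (hforcing F).
Proof. by move=> fF; apply/hfinite_hset/finite_image. Qed.

Lemma hfin_unionP U P : countable P ->
  hfin_union U (hforcing P) <-> exists2 T, fin_unions P T & U = htree T.
Proof.
move=> cP; split=> [[F [fF [S0 S0F] FP UF]]|[T [F [fF [S0 F0] FP ->]] ->]].
  have [F0 [fF0 F0P F0F]] := hfinite_sub_hforcing cP fF FP.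
  exists (\bigcup_(S in F0) S).
    exists F0; split=> //; have /F0F[S ? _] := S0F; by exists S.
  apply: hc_ext => z; rewrite UF in_htree; split.
    move=> [_ [/F0F[S FS ->]]]; rewrite in_htree => -[s Ss ->].
    by exists s => //; exists S.
  by move=> [s [S FS Ss] ->]; exists (htree S); rewrite hstring_in_htree F0F; split=> //; exists S.
have cF := finite_set_countable fF; exists (hforcing F); split.
- exact: hfinite_hforcing.
- by exists (htree S0); apply/htree_in_hforcing.
- by move=> z /(in_hforcing _ cF)[S /FP PS ->]; apply/htree_in_hforcing.
- move=> z; rewrite in_htree; split=> [[s [S FS Ss] ->]|[_ [/(in_hforcing _ cF)[S FS ->]]]].
    by exists (htree S); rewrite hstring_in_htree htree_in_hforcing.
  by rewrite in_htree => -[s Ss ->]; exists s => //; exists S.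
Qed.

Definition hkey (w : HC * nat) := hpair w.1 (hnat w.2).

Lemma hkey_inj : injective hkey.
Proof. by move=> [x m] [y n] /hpair_inj[/= -> /hnat_inj ->]. Qed.

Lemma in_hsystem f z : finite_set (pdom f) ->
  z \inh hsystem f <-> exists w T, f w = Some T /\ z = hpair (hkey w) (htree T).
Proof. by move=> /finite_set_countable; apply: (in_hfun hkey). Qed.

Lemma in_hsystem_pair f xi k U : finite_set (pdom f) ->
  hpair (hpair xi (hnat k)) U \inh hsystem f <->
  exists2 T, f (xi, k) = Some T & U = htree T.
Proof.
by move=> /finite_set_countable cf; exact: (@in_hfun_pair _ _ hkey htree f (xi, k) U cf hkey_inj).
Qed.

Lemma in_hmulti p xi P : countable (pdom p) ->
  hpair xi P \inh hmulti p <-> exists2 P0, p xi = Some P0 & P = hforcing P0.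
Proof. by move=> cp; apply: in_hfun_pair. Qed.

Lemma pdom_value (p : multi) xi P : p xi = Some P -> pdom p xi /\ value p xi = P.
Proof. by move=> E; rewrite /pdom /value /= E. Qed.

Lemma value_pdom (p : multi) xi : pdom p xi -> p xi = Some (value p xi).
Proof. by rewrite /pdom /value /=; case: (p xi). Qed.

Lemma countable_fin_unions P : countable P -> countable (fin_unions P).
Proof.
move=> /countable_finite_subset; apply: sub_countable.
apply: card_le_trans (card_image_le (fun F => \bigcup_(S in F) S) _).
by apply: subset_card_le => T [F [fF _ FP ->]]; exists F.
Qed.

Section SmallMulti.
Variables (p : multi) (psmall : small p).

Let cp : countable (pdom p) := proj1 psmall.

Lemma countable_value xi : countable (value p xi).
Proof.
case: (asboolP (pdom p xi)) => [/(proj2 psmall)//|].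
by rewrite /pdom /value /=; case: (p xi) => //= _; apply: countable0.
Qed.

(** The formula admits no spurious codes: a set satisfying it is decoded into a condition by reading
    a partial function off its graph. *)
Lemma hcond_predP z :
  hcond_pred z (hmulti p) <-> exists2 c, conds p c & z = hcond c.
Proof.
split=> [[_ [f [-> [n ->] [ff fP ff1]]]]|[[n f] [/= ff fP] ->]].
  pose H w T := hpair (hkey w) (htree T) \inh f.
  (* Excluded middle decides whether [w] has a value; single-valuedness of [f] and injectivity of
     [htree] make the chosen value the only one. *)
  pose g w := if pselect (exists T, H w T) is left h then Some (projT1 (cid h)) else None.
  have gP w T : g w = Some T <-> H w T.
    rewrite /g; case: pselect => [h|h]; last by split=> // HT; case: h; exists T.
    case: cid => S /= HS; split=> [[<-]//|HT]; congr Some; apply: htree_inj.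
    exact: ff1 HS HT.
  have fg : finite_set (pdom g).
    apply: (@finite_inj_image _ _ (fun w => hpair (hkey w) (htree (odflt set0 (g w))))).
      by move=> w w' /hpair_inj[/hkey_inj].
    apply: sub_finite_set ff => _ [w gw <-]; rewrite /pdom /= in gw *.
    by case E: (g w) gw => [T|//] _ /=; apply/gP.
  exists (n, g).
    split=> // xi k T /gP HT; have [xi' [k' [P [U [[k'' ->] Pp]]]]] := fP _ HT.
    move: Pp => /(in_hmulti _ _ cp)[P0 p0 ->] + /hpair_inj[/hpair_inj[/= E _] ET].
    rewrite -{}E in p0; have [px vx] := pdom_value p0; rewrite -{}ET -vx.
    by move=> /(hfin_unionP _ (countable_value xi))[S US /htree_inj ->].
  congr hpair; apply: hc_ext => w.
  rewrite in_hsystem //.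
  split=> [wf|[v [T [/gP HT ->]]] //].
  have [xi [k [P [U [[m ->] Pp UP E]]]]] := fP _ wf.
  move: Pp UP => /(in_hmulti _ _ cp)[P0 p0 ->]; have [px vx] := pdom_value p0.
  rewrite -vx => /(hfin_unionP _ (countable_value _))[T _ UT].
  exists (xi, m), T; split; last by rewrite E UT.
  by apply/gP; rewrite /H -UT -E.
exists (hnat n), (hsystem f); split=> //; first by exists n.
have inf z := in_hsystem z ff.
split.
- apply: sub_finite_set (finite_image (fun w => hpair (hkey w) (htree (odflt set0 (f w)))) ff).
  move=> w /inf[v [T [fv ->]]]; exists v; by rewrite /pdom /= fv.
- move=> w /inf[[xi k] [T [/fP[px UT] ->]]].
  exists xi, (hnat k), (hforcing (value p xi)), (htree T); split=> //.
  + by exists k.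
  + by apply/in_hmulti => //; exists (value p xi) => //; apply: value_pdom.
  + by apply/(hfin_unionP _ (countable_value xi)); exists T.
- move=> w S T /inf[v [S0 [fv /hpair_inj[-> ->]]]] /inf[v' [T0 [fv' /hpair_inj[/hkey_inj E ->]]]].
  by move: fv'; rewrite -E fv => -[->].
Qed.

(** Ensures that [hset] is meaningful on sets of codes of conditions: each code pairs a natural
    number with a finite subset of one countable set of entries. *)
Lemma countable_hcond_pred : countable [set z | hcond_pred z (hmulti p)].
Proof.
pose X := \bigcup_(xi in pdom p)
  ((fun u => hpair (hkey (xi, u.1)) (htree u.2)) @` ([set: nat] `*` fin_unions (value p xi))).
have cX : countable X.
  apply: bigcup_countable => // xi px.
  apply: sub_countable (card_image_le _ _) _.
  exact/countableX/countable_fin_unions/countable_value.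
have := countableX (countableP [set: nat]) (countable_finite_hsets cX).
apply: sub_countable.
apply: card_le_trans (card_image_le (fun u => hpair (hnat u.1) u.2) _).
apply: subset_card_le => _ [_ [f [-> [n ->] [ff fP _]]]]; exists (n, f) => //.
split=> //=; split=> // w /fP[xi [k [P [U [[m ->] + + ->]]]]].
move=> /(in_hmulti _ _ cp)[P0 p0 ->]; have [px vx] := pdom_value p0.
by rewrite -vx => /(hfin_unionP _ (countable_value _))[T UT ->]; exists xi => //; exists (m, T).
Qed.

Variables (M : HC) (c : nat -> cond).
Hypotheses (pM : hmulti p \inh M) (cgen : generic_sequence M p c).

(** All appeals to the last clause of genericity go through here. The parameters are the code of [p]
    and two elements of [M]; natural numbers take no slot, being definable outright. *)
Lemma generic_meets (R : HC -> HC -> HC -> HC -> Prop) (D : set cond) a b :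
  dfn (fun e => R (nth hempty e 0) (nth hempty e 1) (nth hempty e 2) (nth hempty e 3)) ->
  a \inh M -> b \inh M ->
  (forall d, conds p d -> R (hcond d) (hmulti p) a b <-> D d) ->
  (forall d d', conds p d -> conds p d' -> D d' -> cond_le d d' -> D d) ->
  (forall d, conds p d -> exists d', [/\ conds p d', D d' & cond_le d' d]) ->
  exists j, D (c j).
Proof.
move=> dR aM bM RD oD dD; have [_ _ _ meet] := cgen.
have [||||j [_ Dj]] := meet (conds p `&` D); last by exists j.
- by move=> d [].
- have [f fP] : dfn (fun e => forall z, z \inh nth hempty e 0 <->
     hcond_pred z (nth hempty e 1) /\
     R z (nth hempty e 1) (nth hempty e 2) (nth hempty e 3)).
    have dR' := dfn_app4 dR; have dC := dfn_hcond_pred; dfn_auto.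
  (* The environment is the candidate set followed by these three parameters, matching positions 0
     to 3 of [f]. *)
  exists f; exists [:: hmulti p; a; b]; first by case=> [|[|[|]]].
  move=> Y; rewrite fP /= hset_eqP; last first.
    apply: sub_countable countable_hcond_pred; apply: subset_card_le.
    by move=> _ [d [cd _] <-]; apply/hcond_predP; exists d.
  have E z : (hcond_pred z (hmulti p) /\ R z (hmulti p) a b) <->
      (hcond @` (conds p `&` D)) z.
    split=> [[/hcond_predP[d cd ->] /(RD _ cd) Dd]|[d [cd Dd] <-]]; first by exists d.
    by split; [apply/hcond_predP; exists d | apply/RD].
  by split=> H z; rewrite H E.
- split=> [d []//|d d' cd [cd' Dd'] le]; split=> //; exact: oD Dd' le.
- by split=> [d []//|d /dD[d' [cd' Dd' le]]]; exists d'.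
Qed.
End SmallMulti.

(** * Perfect trees *)

Lemma prefix_total (T : eqType) (s t u : seq T) :
  prefix s u -> prefix t u -> size s <= size t -> prefix s t.
Proof.
by rewrite !prefixE => /eqP su /eqP tu st; rewrite -tu take_takel // su.
Qed.

Lemma prefix_size_eq (T : eqType) (s t : seq T) : prefix s t -> size t <= size s -> s = t.
Proof.
move=> st ts; apply: prefix_anti => //; exact: prefix_total (prefix_refl t) st ts.
Qed.

Section PerfectTree.
Variables (T : tree) (pT : perfect_tree T).

Lemma tree_prefix s t : T t -> prefix s t -> T s.
Proof. by case: pT => _ + _; apply. Qed.

Lemma tree_root : T [::].
Proof. by case: (pT) => -[s Ts] _ _; apply: tree_prefix Ts _; apply: prefix0s. Qed.

Lemma tree_split s : T s -> exists u v,
  [/\ T u, T v, prefix s u & prefix s v] /\ ~ prefix u v /\ ~ prefix v u.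
Proof.
case: pT => _ _ /[apply] -[t [st Tf Tt]]; exists (rcons t false), (rcons t true).
by rewrite !(prefix_trans st (prefix_rcons _ _)) -!cats1 !prefix_catr // eqxx /= !cats1.
Qed.

Lemma tree_extend s n : T s -> size s <= n ->
  exists t, [/\ T t, prefix s t & size t = n].
Proof.
move=> Ts sn; suff [t [Tt st nt]] : exists t, [/\ T t, prefix s t & n <= size t].
  exists (take n t); rewrite size_takel //; split=> //.
    by apply: tree_prefix Tt _; apply: prefix_take.
  by apply: prefix_total st (prefix_take _ _) _; rewrite size_takel.
rewrite -(subnKC sn); elim: (n - size s) => [|m [t [Tt st mt]]].
  by exists s; rewrite addn0 prefix_refl.
case: pT => _ _ /(_ t Tt)[u [tu uf _]]; exists (rcons u false); split=> //.
  exact: prefix_trans st (prefix_trans tu (prefix_rcons _ _)).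
by rewrite size_rcons addnS ltnS; apply: leq_trans mt (size_prefix tu).
Qed.

Lemma restr_perfect s : T s -> perfect_tree (restr T s).
Proof.
move=> Ts; split.
- by exists s; split=> //; left; apply: prefix_refl.
- move=> u t [Tt ts] ut; split; first exact: tree_prefix Tt ut.
  case: ts => [st|ts]; last by right; apply: prefix_trans ut ts.
  have [le|/ltnW le] := leqP (size s) (size u); [left | right].
    exact: prefix_total st ut le.
  exact: prefix_total ut st le.
- move=> u [Tu us]; have [v [uv sv Tv]] : exists v, [/\ prefix u v, prefix s v & T v].
    by case: us => us; [exists u | exists s]; rewrite ?prefix_refl.
  case: pT => _ _ /(_ v Tv)[t [vt tf tt]]; exists t; split; first exact: prefix_trans vt.
    by split=> //; left; apply: prefix_trans sv (prefix_trans vt (prefix_rcons _ _)).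
  by split=> //; left; apply: prefix_trans sv (prefix_trans vt (prefix_rcons _ _)).
Qed.

(** [T] has a node of length [size s]; it is comparable with [s], hence equal to it. *)
Lemma tree_sub_restr U s : T `<=` restr U s -> T s.
Proof.
move=> TU; have [t [Tt _ ts]] := tree_extend tree_root (leq0n (size s)).
have [_ [st|st]] := TU _ Tt.
  by rewrite (prefix_size_eq st) // ts.
by rewrite -(prefix_size_eq st) // ts.
Qed.

End PerfectTree.

(** The splitting node is the longest common initial segment of the incomparable [u] and [v]; since
    both extend [s], so does it. *)
Lemma split_perfect (T : tree) : T !=set0 ->
  (forall s t, T t -> prefix s t -> T s) ->
  (forall s, T s -> exists u v,
    [/\ T u, T v, prefix s u & prefix s v] /\ ~ prefix u v /\ ~ prefix v u) ->
  perfect_tree T.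
Proof.
move=> T0 Tp Ts; split=> // s /Ts[u [v [[Tu Tv su sv] [uv vu]]]].
suff [t [b [tu tv st]]] : exists t b,
    [/\ prefix (rcons t b) u, prefix (rcons t (~~ b)) v & prefix s t].
  have Tb := Tp _ _ Tu tu; have Tnb := Tp _ _ Tv tv.
  by exists t; case: b Tb Tnb {tu tv} => /=.
elim: s u v su sv uv vu {Tu Tv} => [|x s IH] u v.
  move=> _ _; elim: u v => [|a u IHu] [|b v] //=.
  have [->|ab] := eqVneq a b; last first.
    move=> _ _; exists [::], a; rewrite /= !prefix0s eqxx; split=> //.
    by case: a b ab => -[].
  move=> uv vu; have [||t [d [tu tv _]]] := IHu v.
  - by move=> H; apply: uv.
  - by move=> H; apply: vu.
  by exists (b :: t), d; rewrite /= eqxx.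
case: u v => [|a u] [|b v] //= /andP[/eqP<- su] /andP[/eqP<- sv]; rewrite eqxx /= => uv vu.
have [t [d [tu tv st]]] := IH _ _ su sv uv vu.
by exists (x :: t), d; rewrite /= eqxx.
Qed.

Lemma restr_sub T s : restr T s `<=` T.
Proof. by move=> t []. Qed.

Lemma restrS S T s : S `<=` T -> restr S s `<=` restr T s.
Proof. by move=> ST t [/ST Tt ?]; split. Qed.

Lemma restr_root T : restr T [::] = T.
Proof.
by apply/seteqP; split=> t; [case | split=> //; left; apply: prefix0s].
Qed.

Lemma mem_restr (T : tree) s : T s -> restr T s s.
Proof. by move=> Ts; split=> //; left; apply: prefix_refl. Qed.

Lemma fin_unions_perfect P : P `<=` perfect_tree -> fin_unions P `<=` perfect_tree.
Proof.
move=> PT _ [F [_ [S0 F0] FP ->]]; split.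
- by exists [::]; exists S0 => //; apply: tree_root; apply/PT/FP.
- move=> s t [S FS St] st; exists S => //; apply: tree_prefix St st; exact/PT/FP.
- move=> s [S FS Ss]; have [_ _ /(_ s Ss)[t [st tf tt]]] := PT _ (FP _ FS).
  by exists t; split=> //; exists S.
Qed.

Lemma finite_strings n : finite_set [set s : seq bool | size s = n].
Proof.
apply: (@sub_finite_set _ _ ((@tval n bool) @` [set: n.-tuple bool])) => [s /= sn|].
  by exists (tcast sn (in_tuple s)); rewrite ?val_tcast.
exact/finite_image/finite_finset.
Qed.

Lemma finite_prefixes s : finite_set [set t : seq bool | prefix t s].
Proof.
apply: (@sub_finite_set _ _ ((fun n => take n s) @` `I_(size s).+1)) => [t ts|].
  exists (size t); first by rewrite /= ltnS; apply: size_prefix.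
  by move: ts; rewrite /= prefixE => /eqP.
exact/finite_image/finite_II.
Qed.

Section Arboreal.
Variables (P : set tree) (aP : arboreal P).

Let PT : P `<=` perfect_tree := proj1 aP.

Lemma fin_unions_restr U s : fin_unions P U -> U s ->
  exists S, [/\ P S, S `<=` restr U s & S s].
Proof.
move=> [F [_ _ FP ->]] [S FS Ss]; exists (restr S s); split.
- by apply: (proj2 aP) => //; apply: FP.
- by apply: restrS => t St; exists S.
- exact: mem_restr.
Qed.

Definition glue n (U : tree) (R : seq bool -> tree) : tree :=
  [set t | exists s, [/\ size s = n, U s & R s t]].

(** There are finitely many nodes of length [n], so the union is finite. None of them is lost,
    because a perfect subtree of [restr U s] contains [s]. *)
Lemma glue_shrink n U R : fin_unions P U ->
  (forall s, size s = n -> U s -> P (R s) /\ R s `<=` restr U s) ->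
  fin_unions P (glue n U R) /\ tree_le n (glue n U R) n U.
Proof.
move=> FU RU; have pU := fin_unions_perfect PT FU; split.
  exists (R @` [set s | size s = n /\ U s]); split.
  - by apply/finite_image; apply: sub_finite_set (finite_strings n) => s [].
  - have [t [Ut _ tn]] := tree_extend pU (tree_root pU) (leq0n n).
    by exists (R t); exists t.
  - by move=> _ [s [sn Us] <-]; case: (RU s sn Us).
  - apply/seteqP; split=> [t [s [sn Us Rt]]|t [_ [s [sn Us] <-] Rt]]; last by exists s.
    by exists (R s) => //; exists s.
split=> //.
  by move=> t [s [sn Us Rt]]; have [_ /(_ t Rt)[]] := RU s sn Us.
apply/seteqP; split=> t [Ut tn]; split=> //.
  by case: Ut => s [sn Us Rt]; have [_ /(_ t Rt)[]] := RU s sn Us.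
exists t; split=> //; have [PR RS] := RU t tn Ut.
exact (tree_sub_restr (PT PR) RS).
Qed.

(** Induction on the cover: if [T] is not inside the first tree [S], restrict it to a node [t]
    outside [S]. No extension of [t] lies in [S], so the remaining trees cover the restriction. *)
Lemma fin_covered_restr T D : P T -> fin_covered T D -> D `<=` perfect_tree ->
  exists R S, [/\ P R, R `<=` T, D S & R `<=` S].
Proof.
move=> PT0 [F [/finite_seqP[l ->] lD TF]] DT.
have {TF} : forall t, T t -> exists S, S \in l /\ S t.
  by move=> t /TF[S lS St]; exists S.
have {lD} : forall S, S \in l -> D S by move=> S; apply: lD.
elim: l T PT0 => [|S l IH] T PT0 lD Tl.
  by have [S []] := Tl _ (tree_root (PT PT0)).
have [TS|/existsNP[t /not_implyP[Tt nSt]]] := pselect (T `<=` S).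
  by exists T, S; split=> //; apply: lD; rewrite inE eqxx.
have [|t' [tt' Stt']|R [S' [PR Rt DS' RS']]] := IH (restr T t) (proj2 aP _ _ PT0 Tt).
- by move=> S' lS'; apply: lD; rewrite inE lS' orbT.
(* A node of the restriction shorter than [t] may lie in [S], so it is first extended to a node [v]
   above [t]; the tree that contains [v] contains it too. *)
- have [v [Tv t'v tv]] : exists v, [/\ T v, prefix t' v & prefix t v].
    by case: Stt' => st; [exists t' | exists t]; rewrite ?prefix_refl.
  have [S' []] := Tl v Tv; rewrite inE => /predU1P[->|lS'] Sv.
    case: nSt; apply: tree_prefix Sv tv; apply/DT/lD; by rewrite inE eqxx.
  exists S'; split=> //; apply: tree_prefix Sv t'v; apply/DT/lD.
  by rewrite inE lS' orbT.
- by exists R, S'; split=> // w /Rt[].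
Qed.

End Arboreal.

(** * Branches and relative clopenness *)

Lemma finite_strings_bounded (A : tree) : finite_set A ->
  exists N, forall s, A s -> size s < N.
Proof.
move=> /finite_seqP[l ->]; exists (\max_(s <- l) size s).+1 => s sl.
by rewrite ltnS; apply: leq_bigmax_seq.
Qed.

Lemma mkseq_prefix (a : cantor_space) m n : m <= n -> prefix (mkseq a m) (mkseq a n).
Proof.
move=> mn; rewrite prefixE size_mkseq /mkseq -map_take take_iota.
by rewrite (minn_idPl mn).
Qed.

Lemma branches_prefix_closed (T : tree) N (a : cantor_space) :
  (forall s t, T t -> prefix s t -> T s) ->
  (forall n, N <= n -> T (mkseq a n)) -> branches T a.
Proof.
move=> Tp Ta n; apply: Tp (Ta (maxn n N) (leq_maxr _ _)) _.
exact/mkseq_prefix/leq_maxl.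
Qed.

Lemma branches_finite (T : tree) : finite_set T -> branches T = set0.
Proof.
move=> /finite_strings_bounded[N TN]; rewrite -subset0 => a aT.
by have := TN _ (aT N); rewrite size_mkseq ltnn.
Qed.

Lemma branches_setI (S T : tree) : branches S `&` branches T = branches (S `&` T).
Proof.
by apply/seteqP; split=> [a [aS aT] n|a aST]; split=> // n; have [] := aST n.
Qed.

(** Induction on [n], splitting by the last coordinate read: each piece is a shorter cylinder
    intersected with the preimage of a point under a projection. *)
Lemma open_cylinder n (A : tree) : open [set a : cantor_space | A (mkseq a n)].
Proof.
elim: n A => [|n IH] A.
  have [A0|nA0] := pselect (A [::]).
    rewrite (_ : mkset _ = setT); first exact: openT.
    by rewrite predeqE.
  rewrite (_ : mkset _ = set0); first exact: open0.
  by rewrite predeqE.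
pose B b := [set a : cantor_space | A (rcons (mkseq a n) b)] `&` (proj n @^-1` [set b]).
rewrite (_ : mkset _ = \bigcup_b B b).
  apply: bigcup_open => b _; apply: openI; first exact: (IH [set s | A (rcons s b)]).
  apply: open_comp; [move=> + _; exact: proj_continuous| exact: discrete_open].
rewrite predeqE => a; rewrite /= mkseqS; split=> [H|[b _ [/= H E]]].
  by exists (a n).
by rewrite -[a n]/(proj n a) E.
Qed.

Lemma closed_branches (T : tree) : closed (branches T).
Proof.
rewrite (_ : branches T = \bigcap_n ~` [set a : cantor_space | ~ T (mkseq a n)]).
  by apply: closed_bigI => n _; apply: open_closedC; apply: (open_cylinder n (~` T)).
rewrite predeqE => a; split=> [aT n _ /=|aT n]; first by rewrite notK.
by apply: contrapT; apply: (aT n).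
Qed.

(** The cover consists of trees inside [T] and trees meeting [T] finitely. Among the branches of
    [S], those in [T] are exactly those that leave the union [B] of the second kind, which is closed
    under prefixes. *)
Lemma clopen_covered (S T : tree) : perfect_tree T ->
  fin_covered S [set R | perfect_tree R /\ (R `<=` T \/ finite_set (R `&` T))] ->
  relatively_clopen (branches S) (branches T).
Proof.
move=> pT [F [fF FE SF]].
pose B := \bigcup_(R in [set R | F R /\ finite_set (R `&` T)]) R.
have fB : finite_set (B `&` T).
  rewrite (_ : _ `&` _ =
    \bigcup_(R in [set R | F R /\ finite_set (R `&` T)]) (R `&` T)); last first.
    by rewrite setI_bigcupl.
  by apply: bigcup_finite => [|R [] //]; apply: (sub_finite_set _ fF) => R [].
have Bp s t : B t -> prefix s t -> B s.
  move=> [R [FR fR] Rt] st; exists R => //; apply: tree_prefix Rt st.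
  by have [] := FE _ FR.
split; last first.
  apply/closed_subspaceP; exists (branches T); first exact: closed_branches.
  by apply/seteqP; split=> [a []|a [[]]].
apply/open_subspaceP; exists (~` branches B).
  by rewrite openC; apply: closed_branches.
apply/seteqP; split=> a.
  move=> [naB aS]; split=> //; split=> //.
  (* From level [m] on the branch is outside [B], so its nodes are covered by trees inside [T]. *)
  have [m nBm] : exists m, ~ B (mkseq a m) by apply/existsNP.
  apply: (@branches_prefix_closed _ m); first by move=> s t; apply: tree_prefix.
  move=> n mn; have [R FR Ra] := SF _ (aS n).
  have [_ [|fR]] := FE _ FR; first exact.
  by case: nBm; apply: Bp (mkseq_prefix a mn); exists R.
move=> [[aS aT] _]; split=> // aB.
have : branches (B `&` T) a by move=> n; split.
by rewrite branches_finite.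
Qed.

(** * Conditions *)

Definition upd (f : system) (w : HC * nat) (T : tree) : system :=
  fun v => if v == w then Some T else f v.

Lemma tree_le_refl n m T : m <= n -> tree_le n T m T.
Proof. by move=> mn; split. Qed.

(** Perfectness enters because a node of length [n3] has to be extended to length [n2], where the
    first relation preserves it. *)
Lemma tree_le_trans n1 T1 n2 T2 n3 T3 :
  tree_le n1 T1 n2 T2 -> tree_le n2 T2 n3 T3 -> perfect_tree T1 -> perfect_tree T2 ->
  tree_le n1 T1 n3 T3.
Proof.
move=> [n21 T12 E12] [n32 T23 E23] p1 p2; split.
- exact: leq_trans n21.
- exact: subset_trans T23.
- rewrite -E23; apply/seteqP; split=> s [Ts sn]; split=> //; first exact: T12.
  have [t [Tt st tn]] : exists t, [/\ T2 t, prefix s t & size t = n2].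
    by apply: tree_extend; rewrite // sn.
  apply: tree_prefix st => //.
  by have [] : (T1 `&` [set s | size s = n2]) t by rewrite E12.
Qed.

Lemma tree_le_mem n T m S s : perfect_tree S -> perfect_tree T -> tree_le n T m S ->
  S s -> size s <= m -> T s.
Proof.
move=> pS pT [mn TS E] Ss sm; have [t [St st tm]] := tree_extend pS Ss sm.
apply: (tree_prefix pT) st.
by have [] : (T `&` [set s | size s = m]) t by rewrite E.
Qed.

Section Conditions.
Variables (p : multi) (pmf : multiforcing p).

Lemma system_perfect f w T : is_system p f -> f w = Some T -> perfect_tree T.
Proof.
case: w => xi k [_ fP] /fP[px]; apply: fin_unions_perfect.
exact: (proj1 (proj2 pmf _ px)).
Qed.

Lemma cond_le_refl d : cond_le d d.
Proof. by move=> w T fw; exists T => //; apply: tree_le_refl. Qed.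

Lemma cond_le_trans d1 d2 d3 : conds p d1 -> conds p d2 ->
  cond_le d1 d2 -> cond_le d2 d3 -> cond_le d1 d3.
Proof.
move=> c1 c2 d12 d23 w T3 /d23[T2 w2 T23]; have [T1 w1 T12] := d12 _ _ w2.
exists T1 => //; apply: tree_le_trans T12 T23 _ _; [apply: system_perfect w1|apply: system_perfect w2]; done.
Qed.

Lemma is_system_upd f xi k T : is_system p f -> pdom p xi ->
  fin_unions (value p xi) T -> is_system p (upd f (xi, k) T).
Proof.
move=> [ff fP] px UT; split.
  apply: (@sub_finite_set _ _ (pdom f `|` [set (xi, k)])) => [w|].
    by rewrite /pdom /upd /=; case: eqP => [->|_] ?; [right | left].
  by rewrite finite_setU; split=> //; apply: finite_set1.
by move=> eta l S; rewrite /upd; case: eqP => [[-> _] [<-]//|_ /fP].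
Qed.

Lemma upd_same f w T : upd f w T w = Some T.
Proof. by rewrite /upd eqxx. Qed.

Lemma upd_other f v w T : v <> w -> upd f w T v = f v.
Proof. by rewrite /upd => /eqP/negPf ->. Qed.

Lemma cond_le_upd n f w U T : f w = Some U -> tree_le n T n U ->
  cond_le (n, upd f w T) (n, f).
Proof.
move=> fw TU v S fv; rewrite /upd /=; case: eqP => [E|_]; last by exists S => //; apply: tree_le_refl.
by exists T => //; move: fv; rewrite /= E fw => -[<-].
Qed.

Lemma cond_le_new n f w T : f w = None -> cond_le (n, upd f w T) (n, f).
Proof.
move=> fw v S fv; rewrite /upd /=; case: eqP => [E|_]; last by exists S => //; apply: tree_le_refl.
by move: fv; rewrite /= E fw.
Qed.

Lemma fin_unions1 (P : set tree) T : P T -> fin_unions P T.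
Proof.
move=> PT; exists [set T]; split.
- exact: finite_set1.
- by exists T.
- by move=> _ ->.
- by rewrite bigcup_set1.
Qed.

Lemma dense_dom xi k T d : pdom p xi -> value p xi T -> conds p d ->
  exists d', [/\ conds p d', cond_le d' d & exists U, d'.2 (xi, k) = Some U].
Proof.
case: d => n f px pT cd; case E: (f (xi, k)) => [U|].
  by exists (n, f); split=> //; [apply: cond_le_refl | exists U].
exists (n, upd f (xi, k) T); split; last by exists T; apply: upd_same.
- by apply: is_system_upd => //; apply: fin_unions1.
- exact: cond_le_new.
Qed.

Lemma dense_cover xi k (E : set tree) d : pdom p xi -> value p xi !=set0 ->
  (forall T, value p xi T -> exists R, [/\ value p xi R, R `<=` T & E R]) ->
  conds p d -> exists d',
  [/\ conds p d', exists2 U, d'.2 (xi, k) = Some U & fin_covered U E & cond_le d' d].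
Proof.
move=> px [T0 pT0] dE cd; have [[n f] [cf fd [U fU]]] := dense_dom k px pT0 cd.
have aP := proj2 pmf _ px.
have /= FU := proj2 (proj2 cf _ _ _ fU).
have /choice[R RP] s : exists R, size s = n -> U s ->
    [/\ value p xi R, R `<=` restr U s & E R].
  have [Us|?] := pselect (U s); last by exists set0.
  have [S [PS SU _]] := fin_unions_restr aP FU Us.
  by have [R [PR RS ER]] := dE S PS; exists R => _ _; split=> //; apply: subset_trans SU.
have [|FG GU] := @glue_shrink _ aP n U R FU.
  by move=> s sn Us; have [] := RP s sn Us.
exists (n, upd f (xi, k) (glue n U R)); split.
- exact: is_system_upd.
- exists (glue n U R); first exact: upd_same.
  exists (R @` [set s | size s = n /\ U s]); split.
  + by apply/finite_image; apply: sub_finite_set (finite_strings n) => s [].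
  + by move=> _ [s [sn Us] <-]; have [] := RP s sn Us.
  + by move=> t [s [sn Us Rt]]; exists (R s) => //; exists s.
- have cG : conds p (n, upd f (xi, k) (glue n U R)) by apply: is_system_upd.
  by apply: (cond_le_trans cG cf _ fd); apply: cond_le_upd fU _.
Qed.

(** The bound by [n] makes the splitting persist under stronger conditions, which keep all nodes of
    length at most [n]. *)
Definition splits (s : seq bool) n (U : tree) := U s -> exists u v,
  [/\ U u, U v, prefix s u & prefix s v] /\
  [/\ ~ prefix u v, ~ prefix v u, size u <= n & size v <= n].

(** Once a tree is present at [(xi, k)], only the number is raised, up to the lengths of two
    incomparable extensions of [s]. *)
Lemma dense_splits xi k s d : pdom p xi -> value p xi !=set0 ->
  conds p d -> exists d',
  [/\ conds p d', exists2 U, d'.2 (xi, k) = Some U & splits s d'.1 U & cond_le d' d].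
Proof.
move=> px [T0 pT0] cd; have [[n f] [cf fd [U fU]]] := dense_dom k px pT0 cd.
have [Us|nUs] := pselect (U s); last by exists (n, f); split=> //; exists U.
have [u [v [Uuv [uv vu]]]] := tree_split (system_perfect cf fU) Us.
have cf' : conds p (maxn n (maxn (size u) (size v)), f) by [].
exists (maxn n (maxn (size u) (size v)), f); split=> //.
  exists U => // _; exists u, v; split=> //; split=> //=.
    by rewrite !leq_max leqnn orbT.
  by rewrite !leq_max leqnn !orbT.
apply: (cond_le_trans cf' cf _ fd) => w T fw; exists T => //.
exact/tree_le_refl/leq_maxl.
Qed.

(** The domain is finite, so some index [(xi, k)] is free and can receive [T] itself. *)
Lemma dense_below xi T d : pdom p xi -> value p xi T ->
  conds p d -> exists d',
  [/\ conds p d', exists k, exists2 U, d'.2 (xi, k) = Some U & U `<=` T & cond_le d' d].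
Proof.
case: d => n f px pT cd; have [k fk] : exists k, f (xi, k) = None.
  apply: contrapT => /forallNP H; apply: infinite_nat.
  apply: (@finite_inj_image _ _ (pair xi)) => [x y []//|].
  apply: sub_finite_set (proj1 cd) => _ [k _ <-]; rewrite /pdom /=.
  by case E: (f (xi, k)) => //; case: (H k).
exists (n, upd f (xi, k) T); split.
- by apply: is_system_upd => //; apply: fin_unions1.
- by exists k, T => //; apply: upd_same.
- exact: cond_le_new.
Qed.

(** Take incomparable [u] and [v] in [S] above [s]. If [u] is in [S'], restrict [S] to [v] and [S']
    to [u]; otherwise the restriction of [S] to [u] shares only prefixes of [u] with [S']. *)
Lemma disjoint_restrictions P P' S S' s : arboreal P -> arboreal P' -> P S -> P' S' ->
  S s -> S' s -> exists R R', [/\ P R, P' R', R `<=` S, R' `<=` S' & finite_set (R `&` R')].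
Proof.
move=> [PT aP] [PT' aP'] PS PS' Ss Ss'.
have [u [v [[Su Sv su sv] [uv vu]]]] := tree_split (PT _ PS) Ss.
have [S'u|nS'u] := pselect (S' u).
  exists (restr S v), (restr S' u).
  split; [exact: aP | exact: aP' | exact: restr_sub | exact: restr_sub |].
  apply: (@sub_finite_set _ _ ([set t | prefix t v] `|` [set t | prefix t u])); last first.
    by rewrite finite_setU; split; apply: finite_prefixes.
  move=> t [[_ [vt|tv]] [_ [ut|tu]]]; try by [left|right].
  case: (leqP (size u) (size v)) => [|/ltnW] le.
    by case: uv; apply: prefix_total ut vt le.
  by case: vu; apply: prefix_total vt ut le.
exists (restr S u), S'; split; [exact: aP | by [] | exact: restr_sub | by [] |].
apply: sub_finite_set (finite_prefixes u) => t [[_ [ut|//]] S't].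
by case: nS'u; apply: tree_prefix S't ut; apply: PT'.
Qed.

Lemma dense_disjoint xi k eta l d : pdom p xi -> pdom p eta ->
  value p xi !=set0 -> value p eta !=set0 -> (xi, k) <> (eta, l) ->
  conds p d -> exists d', [/\ conds p d',
    exists U V, [/\ d'.2 (xi, k) = Some U, d'.2 (eta, l) = Some V & finite_set (U `&` V)]
    & cond_le d' d].
Proof.
move=> px pe [T0 pT0] [T1 pT1] ne cd.
have [d1 [cd1 d1d [U1 d1U]]] := dense_dom k px pT0 cd.
have [[n f] [cf fd1 [V fV]]] := dense_dom l pe pT1 cd1.
have [U fU _] := fd1 _ _ d1U; have fd := cond_le_trans cf cd1 fd1 d1d.
have aP := proj2 pmf _ px; have aP' := proj2 pmf _ pe.
have /= FU := proj2 (proj2 cf _ _ _ fU); have /= FV := proj2 (proj2 cf _ _ _ fV).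
(* The replacements in both trees are chosen together; when only one tree contains [s], the other
   component is arbitrary. *)
have /choice[R RP] s : exists R : tree * tree,
    [/\ U s -> value p xi R.1 /\ R.1 `<=` restr U s,
        V s -> value p eta R.2 /\ R.2 `<=` restr V s &
        U s -> V s -> finite_set (R.1 `&` R.2)].
  have [Us|nUs] := pselect (U s); have [Vs|nVs] := pselect (V s).
  - have [S [PS SU Ss]] := fin_unions_restr aP FU Us.
    have [S' [PS' SV' Ss']] := fin_unions_restr aP' FV Vs.
    have [R [R' [PR PR' RS RS' fR]]] := disjoint_restrictions aP aP' PS PS' Ss Ss'.
    by exists (R, R'); split=> //= _; split=> //; [apply: subset_trans SU|apply: subset_trans SV'].
  - by have [S [PS SU _]] := fin_unions_restr aP FU Us; exists (S, S).
  - by have [S [PS SV _]] := fin_unions_restr aP' FV Vs; exists (S, S).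
  - by exists (set0, set0).
have [|FG GU] := @glue_shrink _ aP n U (fun s => (R s).1) FU.
  by move=> s _; have [] := RP s.
have [|FH HV] := @glue_shrink _ aP' n V (fun s => (R s).2) FV.
  by move=> s _; have [] := RP s.
set G := glue n U _ in FG GU; set H := glue n V _ in FH HV.
pose f1 := upd f (xi, k) G; pose f2 := upd f1 (eta, l) H.
have c1 : conds p (n, f1) by apply: is_system_upd.
have c2 : conds p (n, f2) by apply: is_system_upd.
exists (n, f2); split=> //.
  exists G, H; split; [by rewrite /= /f2 upd_other // /f1 upd_same | exact: upd_same|].
  (* A common node of [G] and [H] is either a prefix of a string of length [n], or lies above the
     same [s] in both, hence in [A s]. *)
  pose A (s : seq bool) := if `[< U s /\ V s >] then (R s).1 `&` (R s).2 else set0.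
  apply: (@sub_finite_set _ _ ((\bigcup_(s in [set s | size s = n]) A s) `|`
     (\bigcup_(s in [set s | size s = n]) [set t | prefix t s]))).
    move=> t [[s [sn Us Rt]] [s' [sn' Vs' Rt']]].
    have [/(_ Us)[_ /(_ _ Rt)[_ st]] _ _] := RP s.
    have [_ /(_ Vs')[_ /(_ _ Rt')[_ st']] _] := RP s'.
    case: st => [st|ts]; last by right; exists s.
    case: st' => [st'|ts']; last by right; exists s'.
    have E : s = s'.
      by apply: prefix_size_eq; rewrite ?sn ?sn' //; apply: prefix_total st st' _; rewrite sn sn'.
    rewrite -{}E in Vs' Rt'.
    by left; exists s => //; rewrite /A; case: asboolP => // -[].
  rewrite finite_setU; split; apply: bigcup_finite => [|s _]; try exact: finite_strings.
    by rewrite /A; case: asboolP => [[Us Vs]|//]; have [_ _] := RP s; apply.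
  exact: finite_prefixes.
apply: (cond_le_trans c2 cf _ fd); apply: (cond_le_trans c2 c1).
  by apply: cond_le_upd HV; rewrite /f1 upd_other // => E; apply: ne.
exact: cond_le_upd fU GU.
Qed.

End Conditions.

(** * Generic sequences *)

Lemma hpair_trans M x y : htransitive M -> hpair x y \inh M -> x \inh M /\ y \inh M.
Proof.
move=> tM xyM; have H : hset [set x; y] \inh M.
  by apply: tM xyM; apply/in_hset2; right.
by split; apply: tM H; apply/in_hset2; [left | right].
Qed.

Lemma omega1_in x y : omega1 x -> y \inh x -> omega1 y.
Proof.
by move=> [tx ty] yx; split=> [|z zy]; apply: ty => //; apply: tx zy yx.
Qed.

(** Double induction on membership: if neither ordinal belongs to the other, comparing each member
    of one with the other shows that they have the same members. *)
Lemma omega1_total x y : omega1 x -> omega1 y -> [\/ x \inh y, x = y | y \inh x].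
Proof.
elim/hin_ind: x y => x IHx; elim/hin_ind => y IHy ox oy.
have [xy|nxy] := pselect (x \inh y); first by constructor 1.
have [yx|nyx] := pselect (y \inh x); first by constructor 3.
constructor 2; apply: hc_ext => z; split=> [zx|zy].
  case: (IHx z zx y (omega1_in ox zx) oy) => [//|E|yz]; case: nyx.
    by rewrite -E.
  exact: (proj1 ox) yz zx.
case: (IHy z zy ox (omega1_in oy zy)) => [xz|E|//]; case: nxy.
  exact: (proj1 oy) xz zy.
by rewrite E.
Qed.

Section Generic.
Variables (M : HC) (p : multi) (c : nat -> cond).
Hypotheses (Mtrans : htransitive M) (pmf : multiforcing p) (psmall : small p).
Hypotheses (pM : hmulti p \inh M) (cgen : generic_sequence M p c).

Let cp : countable (pdom p) := proj1 psmall.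

Lemma pdom_in_M xi : pdom p xi -> xi \inh M /\ hforcing (value p xi) \inh M.
Proof.
move=> px; apply: hpair_trans => //; apply: Mtrans pM; apply/in_hmulti => //.
by exists (value p xi) => //; apply: value_pdom.
Qed.

Lemma htree_in_M xi T : pdom p xi -> value p xi T -> htree T \inh M.
Proof.
move=> px pT; apply: Mtrans (proj2 (pdom_in_M px)).
by apply/htree_in_hforcing => //; apply: countable_value.
Qed.

Lemma gen_conds j : conds p (c j).
Proof. by case: cgen. Qed.

Lemma in_hcond d xi k U : conds p d ->
  (exists n f, hcond d = hpair n f /\ hpair (hpair xi (hnat k)) U \inh f) <->
  exists2 T, d.2 (xi, k) = Some T & U = htree T.
Proof.
move=> [fd _]; rewrite -in_hsystem_pair //; split=> [[n [f [/hpair_inj[_ <-] //]]]|H].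
by exists (hnat d.1), (hsystem d.2).
Qed.

(** [E] is kept abstract so that one family of dense sets yields both the covering by pre-dense sets
    and the clopenness. *)
Lemma gen_cover xi k (E : HC -> HC -> Prop) b :
  dfn (fun e => E (nth hempty e 0) (nth hempty e 1)) -> b \inh M ->
  pdom p xi -> value p xi !=set0 ->
  (forall T, value p xi T -> exists R, [/\ value p xi R, R `<=` T & E (htree R) b]) ->
  exists j, exists2 U, (c j).2 (xi, k) = Some U &
    fin_covered U [set S | value p xi S /\ E (htree S) b].
Proof.
move=> dE bM px p0 Ed; have cv := countable_value psmall xi.
(* The witnesses are codes of the tree at [(xi, k)], of the forcing at [xi], and of a finite
   cover. *)
pose R (z p' xi' b' : HC) := exists U P F, [/\
  exists n f, z = hpair n f /\ hpair (hpair xi' (hnat k)) U \inh f,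
  hpair xi' P \inh p', hfinite F /\ forall S, S \inh F -> S \inh P /\ E S b' &
  forall t, t \inh U -> exists S, S \inh F /\ t \inh S].
apply: (@generic_meets p psmall M c pM cgen R
  [set d | exists2 U, d.2 (xi, k) = Some U &
    fin_covered U [set S | value p xi S /\ E (htree S) b]] xi b) => //.
- by have dE' := dfn_app2 dE; rewrite /R; dfn_auto.
- exact: (proj1 (pdom_in_M px)).
- move=> d cd; split.
    move=> [_ [_ [F [/(in_hcond _ _ _ cd)[U dU ->] /(in_hmulti _ _ cp)[P0 p0' ->] [fF FP] UF]]]].
    have [_ v0] := pdom_value p0'; rewrite -{}v0 in FP.
    have [F0 [fF0 F0P FF0]] := hfinite_sub_hforcing cv fF (fun S SF => proj1 (FP S SF)).
    exists U => //; exists F0; split=> //.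
      by move=> S F0S; split; [apply: F0P | apply: (proj2 (FP _ _)); apply/FF0; exists S].
    move=> t Ut; have [|_ [/FF0[S F0S ->]]] := UF (hstring t).
      exact/hstring_in_htree.
    by move=> /hstring_in_htree St; exists S.
  move=> [U dU [F [fF FP UF]]]; exists (htree U), (hforcing (value p xi)), (hforcing F).
  have cF := finite_set_countable fF; split.
  + by apply/in_hcond => //; exists U.
  + by apply/in_hmulti => //; exists (value p xi) => //; apply: value_pdom.
  + split; first exact: hfinite_hforcing.
    by move=> _ /(in_hforcing _ cF)[S /FP[pS ES] ->]; split=> //; apply/htree_in_hforcing.
  + move=> _ /in_htree[t /UF[S FS St] ->]; exists (htree S).
    by split; [apply/htree_in_hforcing | apply/hstring_in_htree].
- move=> d d' cd cd' [U' d'U [F [fF FP UF]]] /(_ _ _ d'U)[U dU [_ UU' _]].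
  by exists U => //; exists F; split=> //; apply: subset_trans UF.
- move=> d cd; have [|d' [cd' [U d'U CU] le]] :=
    @dense_cover p pmf xi k [set S | value p xi S /\ E (htree S) b] d px p0 _ cd.
    by move=> T /Ed[S [pS ST ES]]; exists S.
  by exists d'; split=> //; exists U.
Qed.

Lemma gen_below xi T : pdom p xi -> value p xi T ->
  exists j k, exists2 U, (c j).2 (xi, k) = Some U & U `<=` T.
Proof.
move=> px pT.
pose R (z p' xi' T' : HC) := exists k, hnatural k /\ exists U n f,
  [/\ z = hpair n f, hpair (hpair xi' k) U \inh f & hsub U T'].
apply: (@generic_meets p psmall M c pM cgen R
  [set d | exists k, exists2 U, d.2 (xi, k) = Some U & U `<=` T] xi (htree T)) => //.
- by rewrite /R; dfn_auto.
- exact: (proj1 (pdom_in_M px)).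
- exact: htree_in_M pT.
- move=> d cd; split.
    move=> [_ [[k ->] [U [n [f [dnf UF UT]]]]]].
    have /(in_hcond _ _ _ cd)[V dV E] : exists n f,
      hcond d = hpair n f /\ hpair (hpair xi (hnat k)) U \inh f by exists n, f.
    by exists k, V => //; apply/hsub_htree; rewrite -E.
  move=> [k [U dU UT]]; exists (hnat k); split; first by exists k.
  have /(in_hcond _ _ _ cd)[n [f [dnf Uf]]] : exists2 V, d.2 (xi, k) = Some V & htree U = htree V.
    by exists U.
  by exists (htree U), n, f; split=> //; apply/hsub_htree.
- move=> d d' cd cd' [k [U' d'U UT]] /(_ _ _ d'U)[U dU [_ UU' _]].
  by exists k, U => //; apply: subset_trans UT.
- by move=> d cd; have [d' [cd' H le]] := dense_below px pT cd; exists d'.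
Qed.

Lemma gen_splits xi k s : pdom p xi -> value p xi !=set0 -> hstring s \inh M ->
  exists j, exists2 U, (c j).2 (xi, k) = Some U & splits s (c j).1 U.
Proof.
move=> px p0 sM.
pose R (z p' xi' s' : HC) := exists n f U, [/\ z = hpair n f,
  hpair (hpair xi' (hnat k)) U \inh f & s' \inh U -> exists u v,
    [/\ u \inh U, v \inh U, hsub s' u & hsub s' v] /\
    [/\ ~ hsub u v, ~ hsub v u, hbounded u n & hbounded v n]].
apply: (@generic_meets p psmall M c pM cgen R
  [set d | exists2 U, d.2 (xi, k) = Some U & splits s d.1 U] xi (hstring s)) => //.
- by rewrite /R; dfn_auto.
- exact: (proj1 (pdom_in_M px)).
- move=> d cd; have fd := proj1 cd; split.
    move=> [n [f [U [/hpair_inj[<- <-] /(in_hsystem_pair _ _ _ fd)[V dV ->] H]]]].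
    exists V => // Vs; have [|u [v []]] := H; first exact/hstring_in_htree.
    move=> [/in_htree[u' Vu ->] /in_htree[v' Vv ->] /hsub_hstring su /hsub_hstring sv].
    rewrite !(propext (hsub_hstring _ _)) !(propext (hbounded_hstring _ _)).
    by exists u', v'.
  move=> [U dU sU]; exists (hnat d.1), (hsystem d.2), (htree U); split=> //.
    by apply/in_hsystem_pair => //; exists U.
  move=> /hstring_in_htree/sU[u [v [[Uu Uv su sv] H]]]; exists (hstring u), (hstring v).
  by rewrite !(propext (hstring_in_htree _ _)) !(propext (hsub_hstring _ _))
    !(propext (hbounded_hstring _ _)).
(* Strengthening keeps the nodes up to the old number, in particular [u] and [v], and does not lower
   the number. *)
- move=> d d' cd cd' [U' d'U sU] /(_ _ _ d'U)[U dU UU'].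
  have pU := system_perfect pmf cd dU; have pU' := system_perfect pmf cd' d'U.
  exists U => // Us; have [dd sub _] := UU'.
  have [u [v [[Uu Uv su sv] [uv vu un vn]]]] := sU (sub _ Us).
  exists u, v; split; split=> //; try exact: leq_trans dd; exact: tree_le_mem UU' _ _.
- by move=> d cd; have [d' [cd' H le]] := dense_splits pmf k s px p0 cd; exists d'.
Qed.

Lemma gen_disjoint xi k eta l : pdom p xi -> pdom p eta ->
  value p xi !=set0 -> value p eta !=set0 -> (xi, k) <> (eta, l) ->
  exists j U V, [/\ (c j).2 (xi, k) = Some U, (c j).2 (eta, l) = Some V
                  & finite_set (U `&` V)].
Proof.
move=> px pe p0 p0' ne.
(* Finiteness of the intersection is expressed by a finite [I] that includes it. *)
pose R (z p' xi' eta' : HC) := exists n f U V I, [/\ z = hpair n f,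
  hpair (hpair xi' (hnat k)) U \inh f, hpair (hpair eta' (hnat l)) V \inh f &
  hfinite I /\ forall t, t \inh U -> t \inh V -> t \inh I].
apply: (@generic_meets p psmall M c pM cgen R
  [set d | exists U V, [/\ d.2 (xi, k) = Some U, d.2 (eta, l) = Some V
                  & finite_set (U `&` V)]] xi eta) => //.
- by rewrite /R; dfn_auto.
- exact: (proj1 (pdom_in_M px)).
- exact: (proj1 (pdom_in_M pe)).
- move=> d cd; have fd := proj1 cd; split.
    move=> [n [f [U' [V' [I [/hpair_inj[_ <-] + + [fI UVI]]]]]]].
    move=> /(in_hsystem_pair _ _ _ fd)[U dU EU] /(in_hsystem_pair _ _ _ fd)[V dV EV].
    exists U, V; split=> //; apply: (finite_inj_image hstring_inj).
    apply: sub_finite_set fI => _ [t [Ut Vt] <-].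
    by apply: UVI; rewrite ?EU ?EV; apply/hstring_in_htree.
  move=> [U [V [dU dV fUV]]].
  exists (hnat d.1), (hsystem d.2), (htree U), (htree V), (htree (U `&` V)); split=> //.
  + by apply/in_hsystem_pair => //; exists U.
  + by apply/in_hsystem_pair => //; exists V.
  + split; first exact/hfinite_hset/finite_image.
    by move=> _ /in_htree[t Ut ->] /hstring_in_htree Vt; apply/hstring_in_htree.
- move=> d d' cd cd' [U' [V' [dU dV fUV]]] le.
  have [U dU' [_ UU' _]] := le _ _ dU; have [V dV' [_ VV' _]] := le _ _ dV.
  by exists U, V; split=> //; apply: sub_finite_set fUV; apply: setISS.
- by move=> d cd; have [d' [cd' H le]] := dense_disjoint pmf px pe p0 p0' ne cd; exists d'.
Qed.

End Generic.

(** * The limit trees *)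

Section Limit.
Variables (M : HC) (p : multi) (c : nat -> cond).
Hypotheses (Mtrans : htransitive M) (pmf : multiforcing p) (psmall : small p).
Hypotheses (pM : hmulti p \inh M) (cgen : generic_sequence M p c).

Let Q := limit_tree c.

Let aP xi : pdom p xi -> arboreal (value p xi) := proj2 pmf xi.

Lemma gen_cond_le i j : i <= j -> cond_le (c j) (c i).
Proof.
move=> ij; rewrite -(subnKC ij); elim: (j - i) => [|n IH].
  by rewrite addn0; apply: cond_le_refl.
rewrite addnS; have cc := gen_conds cgen.
by apply: (cond_le_trans pmf (cc _) (cc _) _ IH); case: cgen.
Qed.

Lemma gen_perfect j w U : (c j).2 w = Some U -> perfect_tree U.
Proof. exact: (system_perfect pmf (gen_conds cgen j)). Qed.

Lemma limit_sub j xi k U : (c j).2 (xi, k) = Some U -> Q xi k `<=` U.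
Proof. by move=> jU s [_]; apply; exact: jU. Qed.

(** Earlier stages have larger trees, and later stages keep every node of length at most [(c j).1],
    so these nodes survive to the limit. *)
Lemma limit_mem j xi k U s : (c j).2 (xi, k) = Some U -> U s -> size s <= (c j).1 ->
  Q xi k s.
Proof.
move=> jU Us sn; split; first by exists j; rewrite /pdom /= jU.
move=> i T iT; have [ij|/ltnW ji] := leqP i j.
  by have [V] := gen_cond_le ij iT; rewrite jU => -[<-] [_ + _]; apply.
have [V] := gen_cond_le ji jU; rewrite iT => -[<-] le.
exact: tree_le_mem (gen_perfect jU) (gen_perfect iT) le Us sn.
Qed.

(** Used in two ways: a nonempty limit tree shows that the forcing at [xi] is nonempty, and a node
    in a ground tree has its code in [M]. *)
Lemma limit_inhabited xi k s : Q xi k s -> exists T, value p xi T /\ T s.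
Proof.
move=> [[j +] H]; rewrite /pdom /=; case E: ((c j).2 (xi, k)) => [U|//] _.
have [_ [F [_ _ FP EU]]] := proj2 (gen_conds cgen j) _ _ _ E.
have := H _ _ E; rewrite EU => -[T /FP pT Ts]; by exists T.
Qed.

Lemma limit_perfect xi k : pdom p xi -> value p xi !=set0 -> perfect_tree (Q xi k).
Proof.
move=> px p0.
have sM s : (exists T, value p xi T /\ T s) -> hstring s \inh M.
  move=> [T [pT Ts]]; apply: Mtrans (htree_in_M Mtrans psmall pM px pT).
  exact/hstring_in_htree.
have rootP : exists T, value p xi T /\ T [::].
  by case: p0 => T pT; exists T; split=> //; apply: tree_root; apply: (proj1 (aP px)).
apply: split_perfect.
- have [j [U jU _]] := gen_splits Mtrans pmf psmall pM cgen k px p0 (sM [::] rootP).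
  exists [::]; apply: (limit_mem jU) => //; exact: tree_root (gen_perfect jU).
- move=> s t [D H] st; split=> // j T jT.
  exact: (tree_prefix (gen_perfect jT) (H _ _ jT) st).
(* At this stage [u] and [v] are no longer than the number of the condition, so both survive to the
   limit. *)
- move=> s Qs; have [j [U jU sU]] := gen_splits Mtrans pmf psmall pM cgen k px p0 (sM _ (limit_inhabited Qs)).
  have [u [v [[Uu Uv su sv] [uv vu un vn]]]] := sU (limit_sub jU Qs).
  by exists u, v; split=> //; split=> //; apply: (limit_mem jU).
Qed.

Lemma limit_disjoint xi k eta l : pdom p xi -> pdom p eta -> (xi, k) <> (eta, l) ->
  finite_set (Q xi k `&` Q eta l).
Proof.
move=> px pe ne; have [[s [Qs Qs']]|E] := pselect (Q xi k `&` Q eta l !=set0); last first.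
  by apply: (sub_finite_set _ (finite_set0 _)) => s H; case: E; exists s.
have [T [pT _]] := limit_inhabited Qs; have [T' [pT' _]] := limit_inhabited Qs'.
have [j [U [V [jU jV fUV]]]] := gen_disjoint Mtrans pmf psmall pM cgen px pe
  (ex_intro _ T pT) (ex_intro _ T' pT') ne.
by apply: sub_finite_set fUV; apply: setISS; [exact: (limit_sub jU) | exact: (limit_sub jV)].
Qed.

Lemma limit_below xi T : pdom p xi -> value p xi T -> exists k, Q xi k `<=` T.
Proof.
move=> px pT; have [j [k [U jU UT]]] := gen_below Mtrans psmall pM cgen px pT.
by exists k; apply: subset_trans UT; apply: limit_sub jU.
Qed.

Lemma perfect_infinite T : perfect_tree T -> ~ finite_set T.
Proof.
move=> pT /finite_strings_bounded[N TN].
have [t [Tt _ tN]] := tree_extend pT (tree_root pT) (leq0n N).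
by have := TN _ Tt; rewrite tN ltnn.
Qed.

(* Two incompatible parts of a ground tree contained in [Q xi k] would contain
   limit trees with different indices, one of which is almost disjoint from
   [Q xi k]. *)
Lemma limit_not_sup xi k T : pdom p xi -> value p xi T -> ~ (T `<=` Q xi k).
Proof.
move=> px pT TQ; have p0 : value p xi !=set0 by exists T.
have pT' := proj1 (aP px) _ pT.
have [u [v [[Tu Tv _ _] [uv vu]]]] := tree_split pT' (tree_root pT').
have part w : T w -> exists2 m, Q xi m `<=` restr T w & m = k.
  move=> Tw; have [m Qm] := limit_below px (proj2 (aP px) _ _ pT Tw).
  exists m => //; apply: contrapT => mk.
  apply: (perfect_infinite (limit_perfect m px p0)).
  have := limit_disjoint px px (fun E : (xi, m) = (xi, k) => mk (congr1 snd E)).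
  by apply: sub_finite_set => s Qs; split=> //; apply: TQ; have [] := Qm _ Qs.
have [m Qu mk] := part u Tu; have [m' Qv mk'] := part v Tv; subst m m'.
have pQ := limit_perfect k px p0.
have Qku := tree_sub_restr pQ Qu; have [_ [|]] := Qv _ Qku; first exact: vu.
exact: uv.
Qed.

Lemma limit_cover xi k D : pdom p xi -> hforcing D \inh M -> D `<=` value p xi ->
  pre_dense D (value p xi) -> fin_covered (Q xi k) D.
Proof.
move=> px DM DP [_ [_ dD]].
have [p0|p0] := pselect (value p xi !=set0); last first.
  exists set0; split=> // s Qs; case: p0.
  by have [T [pT _]] := limit_inhabited Qs; exists T.
have cD : countable D.
  by apply: sub_countable (countable_value psmall xi); apply: subset_card_le.
(* With the code of [D] as parameter, [E] asks for inclusion in a member of [D]; its density is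
   pre-density of [D]. *)
pose E R b := exists S, S \inh b /\ hsub R S.
have [|T pT|j [U jU [F [fF FE UF]]]] := gen_cover Mtrans pmf psmall pM cgen k (E := E) _ DM px p0.
- by rewrite /E; dfn_auto.
- have [R [pR [S DS RS]] RT] := dD T pT; exists R; split=> //.
  by exists (htree S); split; [apply/htree_in_hforcing | apply/hsub_htree].
(* Each covering tree is enlarged to a member of [D]. *)
have /choice[g gP] S : exists S', F S -> D S' /\ S `<=` S'.
  have [/FE[_ [_ [/(in_hforcing _ cD)[S' DS' ->] /hsub_htree SS']]]|?] := pselect (F S).
    by exists S'.
  by exists S.
exists (g @` F); split; first exact: finite_image.
  by move=> _ [S /gP[] ? _ <-].
move=> s /(limit_sub jU)/UF[S FS Ss]; exists (g S); first by exists S.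
by have [_] := gP S FS; apply.
Qed.

(** The trees that are inside [T] or almost disjoint from it are dense: if [R] has a node [u]
    outside [T], then [restr R u] meets [T] only in prefixes of [u]. *)
Lemma limit_clopen xi k S T : pdom p xi -> value p xi T -> S `<=` Q xi k ->
  relatively_clopen (branches S) (branches T).
Proof.
move=> px pT SQ; have p0 : value p xi !=set0 by exists T.
have pT' := proj1 (aP px) _ pT.
pose E R b := hsub R b \/ exists I, hfinite I /\
  forall t, t \inh R -> t \inh b -> t \inh I.
have EP R : E (htree R) (htree T) -> R `<=` T \/ finite_set (R `&` T).
  move=> [/hsub_htree|[I [fI RTI]]]; [by left | right].
  apply: (finite_inj_image hstring_inj); apply: sub_finite_set fI => _ [t [Rt Tt] <-].
  by apply: RTI; apply/hstring_in_htree.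
have [|R pR|j [U jU [F [fF FE UF]]]] := gen_cover Mtrans pmf psmall pM cgen k
    (E := E) _ (htree_in_M Mtrans psmall pM px pT) px p0.
- by rewrite /E; dfn_auto.
- have [RT|/existsNP[u /not_implyP[Ru nTu]]] := pselect (R `<=` T).
    by exists R; split=> //; left; apply/hsub_htree.
  exists (restr R u); split; [exact: (proj2 (aP px)) | by move=> t [] |].
  right; exists (htree [set t | prefix t u]); split.
    exact/hfinite_hset/finite_image/finite_prefixes.
  move=> _ /in_htree[t [Rt ut] ->] /hstring_in_htree Tt; apply/hstring_in_htree.
  by case: ut => // ut; case: nTu; apply: tree_prefix Tt ut.
apply: clopen_covered => //; exists F; split=> //.
  by move=> R FR; have [pR /EP RT] := FE R FR; split=> //; apply: (proj1 (aP px)).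
by move=> s /SQ/(limit_sub jU)/UF.
Qed.

End Limit.

(** * Properties of the generic refinement *)

Lemma restr_restr T s u : perfect_tree T -> T s -> restr T s u ->
  exists2 v, T v & restr (restr T s) u = restr T v.
Proof.
move=> pT Ts [Tu [su|us]].
  exists u => //; apply/seteqP; split=> t [H ut].
    by split=> //; case: H.
  split=> //; split=> //; case: ut => ut; first by left; apply: prefix_trans su ut.
  have [le|/ltnW le] := leqP (size s) (size t); [left | right].
    exact: prefix_total su ut le.
  exact: prefix_total ut su le.
exists s => //; apply/seteqP; split=> t [H st]; first by split=> //; case: H.
split; first by split.
case: st => st; first by left; apply: prefix_trans us st.
have [le|/ltnW le] := leqP (size u) (size t); [left | right].
  exact: prefix_total us st le.
exact: prefix_total st us le.
Qed.

Theorem theorem7p3 (M : HC) (p : multi) (Q : HC -> nat -> tree) (r : multi)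
    (Mtrans : htransitive M)
    (pmf : multiforcing p) (psmall : small p) (pM : hmulti p \inh M)
    (rgen : generic_refinement M p Q r) :
  [/\
   (* (i) *)
   [/\ multiforcing r, small r, special r, pdom r = pdom p & mrefines p r],
   (* (ii) *)
   (forall xi eta k l, pdom p xi -> pdom p eta -> (xi, k) <> (eta, l) ->
      branches (Q xi k) `&` branches (Q eta l) = set0),
   (* (iii) *)
   (forall xi, pdom p xi ->
      (forall S T, value r xi S -> value p xi T ->
         relatively_clopen (branches S) (branches T) /\ ~ (T `<=` S)) /\
      value r xi `&` value p xi = set0),
   (* (iv) *)
   (forall xi, pdom p xi ->
      open_in subset (value r xi) (value r xi `|` value p xi) /\
      dense_in subset (value r xi) (value r xi `|` value p xi)) &
   (* (v) and (vi) *)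
   (forall xi (D : set tree), pdom p xi -> hforcing D \inh M ->
      D `<=` value p xi -> pre_dense D (value p xi) ->
      refines_over D (value p xi) (value r xi)) /\
   (forall (lam : HC) (ps : HC -> option multi),
      omega1 lam -> pdom ps = [set a | a \inh lam] ->
      hfun id hmulti ps \inh M ->
      (forall a q, ps a = Some q -> [/\ multiforcing q, small q & special q]) ->
      mseq_increasing ps -> p = mseq_join ps ->
      forall a q, ps a = Some q -> mrefines q r)].
Proof.
have [c [cgen Qlim rE]] := rgen.
have rdom : pdom r = pdom p.
  by rewrite rE predeqE /pdom => xi /=; case: (p xi).
have rval xi : pdom p xi -> value r xi = restrictions (Q xi).
  by rewrite rE /pdom /value /=; case: (p xi).
have rin xi S : pdom p xi -> value r xi S -> exists k s,
    [/\ Q xi k s, S = restr (Q xi k) s & value p xi !=set0].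
  move=> px; rewrite rval // => -[k [s [Qs ->]]]; exists k, s; split=> //.
  move: Qs; rewrite Qlim // => /(limit_inhabited cgen)[T [pT _]].
  by exists T.
have perfQ xi k : pdom p xi -> value p xi !=set0 -> perfect_tree (Q xi k).
  by move=> px p0; rewrite Qlim //; apply: (limit_perfect Mtrans pmf psmall pM cgen k).
have fin2 xi eta k l : pdom p xi -> pdom p eta -> (xi, k) <> (eta, l) ->
    finite_set (Q xi k `&` Q eta l).
  move=> px pe ne; rewrite !Qlim //.
  exact: (limit_disjoint Mtrans pmf psmall pM cgen px pe ne).
have below xi T : pdom p xi -> value p xi T -> exists2 S, value r xi S & S `<=` T.
  move=> px pT; have [k] := limit_below Mtrans psmall pM cgen px pT.
  rewrite -Qlim // => QT; exists (Q xi k) => //; rewrite rval //.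
  exists k, [::]; rewrite restr_root; split=> //.
  by apply: tree_root; apply: perfQ => //; exists T.
have iii xi S T : pdom p xi -> value r xi S -> value p xi T ->
    relatively_clopen (branches S) (branches T) /\ ~ (T `<=` S).
  move=> px /(rin _ _ px)[k [s [_ -> _]]] pT; rewrite Qlim //; split.
    exact: (limit_clopen Mtrans pmf psmall pM cgen px pT (@restr_sub _ s)).
  move=> TQ; apply: (limit_not_sup Mtrans pmf psmall pM cgen (k := k) px pT).
  exact: subset_trans TQ (@restr_sub _ s).
have over xi D : pdom p xi -> hforcing D \inh M -> D `<=` value p xi ->
    pre_dense D (value p xi) -> forall S, value r xi S -> fin_covered S D.
  move=> px DM DP dD S /(rin _ _ px)[k [s [_ -> _]]]; rewrite Qlim //.
  have [F [fF FD QF]] := limit_cover Mtrans pmf psmall pM cgen k px DM DP dD.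
  by exists F; split=> //; apply: subset_trans QF; apply: restr_sub.
have ref xi : pdom p xi -> refines (value p xi) (value r xi).
  move=> px; split; [by move=> T; apply: below| |by move=> S T; apply: iii].
  (* The ground forcing is pre-dense in itself. *)
  apply: over => //; first exact: (proj2 (pdom_in_M Mtrans psmall pM px)).
  by split=> //; split=> [T []//|T pT]; exists T => //; split=> //; exists T.
split.
- split=> //.
  + split; first by rewrite rdom; case: pmf.
    rewrite rdom => xi px; split=> [S|S u].
      by move=> /(rin _ _ px)[k [s [Qs -> p0]]]; apply: restr_perfect => //; apply: perfQ.
    move=> /(rin _ _ px)[k [s [Qs -> p0]]] /(restr_restr (perfQ _ _ px p0) Qs)[v Qv ->].
    by rewrite rval //; exists k, v.
  + split; rewrite rdom; first by case: psmall.
    move=> xi px; rewrite rval //.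
    apply: (sub_countable _ (countableP [set: nat * seq bool])).
    apply: card_le_trans (card_image_le (fun u => restr (Q xi u.1) u.2) _).
    by apply: subset_card_le => _ [k [s [_ ->]]]; exists (k, s).
  + move=> xi; rewrite rdom => px; rewrite rval //.
    (* The limit trees form the antichain; the root condition discards empty ones, which occur only
       when the forcing at [xi] is empty. *)
    exists [set U | exists2 k, U = Q xi k & Q xi k [::]]; split.
    * by move=> _ [k -> Q0]; exists k, [::]; rewrite restr_root.
    * apply: (sub_countable _ (countableP [set: nat])).
      apply: card_le_trans (card_image_le (Q xi) _).
      by apply: subset_card_le => _ [k -> _]; exists k.
    * move=> _ _ [k -> _] [l -> _] ne; apply: fin2 => // -[E].
      by apply: ne; rewrite E.
    * apply/seteqP; split=> S.
        move=> [k [s [Qs ->]]]; exists (Q xi k), s; split=> //; exists k => //.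
        apply: tree_root; apply: perfQ => //.
        by move: Qs; rewrite Qlim // => /(limit_inhabited cgen)[T [pT _]]; exists T.
      by move=> [_ [s [[k -> _] Qs ->]]]; exists k, s.
  + by split; [rewrite rdom | exact: ref].
- move=> xi eta k l px pe ne; rewrite branches_setI; apply: branches_finite.
  exact: fin2.
- move=> xi px; split=> [S T|]; first exact: iii.
  rewrite -subset0 => T [rT pT]; have [_] := iii _ _ _ px rT pT; exact.
- move=> xi px; split; split; try by left.
    (* A ground tree inside a new tree would contradict (iii). *)
    move=> T S [//|pT] rS TS; have [_] := iii _ _ _ px rS pT.
    by move/(_ TS).
  by move=> T [rT|/(below _ _ px)//]; exists T.
split.
  move=> xi D px DM DP dD; split; first exact: ref.
  exact: over.
move=> lam ps olam psdom psM psP psinc pE a q aq.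
have qp xi b q' : ps b = Some q' -> pdom q' xi -> pdom p xi /\ value q' xi `<=` value p xi.
  move=> bq' q'x; have px : pdom p xi.
    by rewrite pE /pdom /mseq_join /=; case: asboolP => // -[]; exists b, q'.
  split=> // T q'T; rewrite pE /value /mseq_join; case: asboolP => [_|[]]; last by exists b, q'.
  by exists b, q'.
have pq xi T : pdom p xi -> value p xi T ->
    exists b q', [/\ ps b = Some q', pdom q' xi & value q' xi T].
  by rewrite pE /pdom /value /mseq_join /=; case: asboolP.
have lamin b q' : ps b = Some q' -> b \inh lam.
  by move=> bq'; have : pdom ps b by [rewrite /pdom /= bq']; rewrite psdom.
split=> [xi qx|xi qx]; first by rewrite rdom; have [] := qp xi a q aq qx.
have [px qP] := qp xi a q aq qx; have [qmf qsmall _] := psP _ _ aq.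
have qM : hforcing (value q xi) \inh M.
  suff qM : hmulti q \inh M by have [] := pdom_in_M Mtrans qsmall qM qx.
  have cps : countable (pdom ps) by rewrite psdom; apply: countable_hin.
  have [] // := @hpair_trans M a (hmulti q) Mtrans.
  by apply: Mtrans psM; apply/in_hfun => //; exists a, q.
(* The first and third clauses are inherited because [value q xi] is a subset of [value p xi]; the
   covering clause follows from (v) once that subset is shown pre-dense. *)
split=> [T qT|S rS|S T rS qT]; [exact/below/qP | | exact/iii/qP].
apply: (over xi) => //; split=> //; split=> [T []//|T pT].
have [b [q' [bq' q'x q'T]]] := pq xi T px pT; have [q'mf _ _] := psP _ _ bq'.
have [_ q'P] := qp xi b q' bq' q'x.
have [ab|E|ba] := omega1_total (omega1_in olam (lamin _ _ aq)) (omega1_in olam (lamin _ _ bq')).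
(* If [T] comes from a later stage, finitely many trees of stage [a] cover it, so some subtree from
   stage [b] lies inside one of them. *)
- have [_ qcov _] := proj2 (psinc _ _ _ _ aq bq' ab) xi qx.
  have [R [S' [q'R RT qS RS]]] := fin_covered_restr (proj2 q'mf _ q'x) q'T (qcov _ q'T)
    (proj1 (proj2 qmf _ qx)).
  by exists R => //; split; [exact: q'P | exists S'].
- move: bq'; rewrite -E aq => -[qq']; exists T => //; split=> //; exists T => //.
  by rewrite qq'.
(* If [T] comes from an earlier stage, it contains a tree of stage [a]. *)
- have [qsub _ _] := proj2 (psinc _ _ _ _ bq' aq ba) xi q'x.
  by have [S' qS ST] := qsub _ q'T; exists S' => //; split; [exact: qP | exists S'].
Qed.
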